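(* Let $\sigma(dx)=\frac1{2\pi}\sqrt{(4-x^2)_+}\,dx$ be the semicircle law on $\mathbb{R}$, and for $\mu\in\mathcal P_2(\mathbb{R})$ let $$I_{\log}(\mu):=-\int_{\mathbb{R}}\int_{\mathbb{R}}\log|x-y|\,\mu(dx)\,\mu(dy)+\frac12\int_{\mathbb{R}}x^2\,\mu(dx)-\frac34.$$ For all $\mu\in\mathcal S_{0,1}:=\{\rho\in\mathcal P_2(\mathbb{R}):\int x\,\rho(dx)=0,\ \int x^2\,\rho(dx)=1\}$ we have $$4\arcsin^2\Big(\frac12\mathcal W_2(\mu,\sigma)\Big)\le2I_{\log}(\mu).$$
   Context: $\mathcal P_2(\mathbb{R})$: Borel probability measures on $\mathbb{R}$ with finite second moment; $\mathcal W_2$ is the 2-Wasserstein distance ($\mathcal W_2^2$ is the infimum over couplings of $\int|x-y|^2$). Convention $\log0:=-\infty$, so $I_{\log}$ takes values in $(-\infty,\infty]$. *)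

(* Defs.v *)
From HB Require Import structures.
From mathcomp Require Import all_boot all_order all_algebra.
From mathcomp Require Import all_classical all_reals all_analysis.
From mathcomp Require Import measurable_realfun ring lra.

Set Implicit Arguments.
Unset Strict Implicit.
Unset Printing Implicit Defensive.

Import Order.TTheory GRing.Theory Num.Theory.
Import numFieldNormedType.Exports.

Local Open Scope classical_set_scope.
Local Open Scope ring_scope.

Section semicircle.
Context {R : realType}.
Local Notation leb := (@lebesgue_measure R).

Definition semicircle_pdf (x : R) : R :=
  Num.sqrt (Num.max (4 - x ^+ 2) 0) / (2 * pi).

Definition semicircle_prob : set (measurableTypeR R) -> \bar R :=
  fun A => (\int[leb]_(x in A) (semicircle_pdf x)%:E)%E.

Lemma semicircle_pdf_ge0 x : 0 <= semicircle_pdf x.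
Proof. by rewrite mulr_ge0// ?sqrtr_ge0// invr_ge0 mulr_ge0// pi_ge0. Qed.

Lemma continuous_semicircle_pdf : continuous semicircle_pdf.
Proof.
move=> x; apply: cvgM; last exact: cvg_cst.
apply: (@continuous_comp _ _ _ (fun x : R => Num.max (4 - x ^+ 2) 0) Num.sqrt);
  last exact: sqrt_continuous.
apply: (@continuous_max _ _ (fun x : R => 4 - x ^+ 2) (cst 0)) => //.
  apply: (@cvgB _ R^o); [exact: cvg_cst|exact: exprn_continuous].
exact: cvg_cst.
Qed.

Lemma measurable_semicircle_pdf : measurable_fun [set: R] semicircle_pdf.
Proof. by apply: continuous_measurable_fun; exact: continuous_semicircle_pdf. Qed.

Let F (t : R) : R := 2 * sin t.

Let is_derive_F (t : R) : is_derive t 1 F (2 * cos t).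
Proof. by rewrite /F; apply: (@is_deriveZ R R^o R^o sin 2 t 1). Qed.

Let F'E : derive1 F = (fun t => 2 * cos t).
Proof.
by apply/funext => t; rewrite derive1E; have [_ ->] := is_derive_F t.
Qed.

Let G (t : R) : R := pi^-1 * (t + sin t * cos t).

Let is_derive_G (t : R) : is_derive t 1 G (2 / pi * cos t ^+ 2).
Proof.
have dsc : is_derive t 1 (fun t : R => sin t * cos t)
    (sin t * (- sin t) + cos t * cos t).
  by apply: (@is_deriveM R R^o (sin : R^o -> R^o) cos t 1).
have did : is_derive t 1 (fun t : R => t) 1 by exact: is_derive_id.
have dG : is_derive t 1 G (pi^-1 * (1 + (sin t * (- sin t) + cos t * cos t))).
  apply: (@is_deriveZ R R^o R^o (fun t : R => t + sin t * cos t) pi^-1 t 1).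
suff -> : 2 / pi * cos t ^+ 2 =
  pi^-1 * (1 + (sin t * (- sin t) + cos t * cos t)) by [].
by rewrite mulrN -!expr2 sin2cos2; ring.
Qed.

Let G'E : derive1 G = (fun t => 2 / pi * cos t ^+ 2).
Proof.
by apply/funext => t; rewrite derive1E; have [_ ->] := is_derive_G t.
Qed.

Let continuousF' : continuous (fun t : R => 2 * cos t).
Proof.
by move=> t; apply: cvgM; [exact: cvg_cst|exact: continuous_cos].
Qed.

Let continuousG' : continuous (fun t : R => 2 / pi * cos t ^+ 2).
Proof.
move=> t; apply: cvgM; first exact: cvg_cst.
apply: (@continuous_comp _ _ _ (@cos R) (fun x => x ^+ 2)).
  exact: continuous_cos.
exact: exprn_continuous.
Qed.

Let derivable_LR (H h : R -> R) (a b : R) :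
  (forall t : R, is_derive t 1 H (h t)) -> derivable_oo_LRcontinuous H a b.
Proof.
move=> dH.
have cH : continuous H.
  by move=> t; apply/differentiable_continuous/derivable1_diffP; case: (dH t).
split.
- by move=> t _; case: (dH t).
- exact/cvg_at_right_filter/cH.
- exact/cvg_at_left_filter/cH.
Qed.

Let semicircle_pdf0 x : ~ (x \in `[(-2 : R), 2]) -> semicircle_pdf x = 0.
Proof.
move=> /negP; rewrite in_itv/= negb_and -!ltNge => x2.
rewrite /semicircle_pdf max_r ?sqrtr0 ?mul0r//.
by case/orP: x2 => x2; rewrite subr_le0; nra.
Qed.

Lemma integral_semicircle_pdf :
  (\int[leb]_x (semicircle_pdf x)%:E = 1%E)%E.
Proof.
have pi0 := pi_gt0 R; have pi_neq0 : (pi : R) != 0 by rewrite gt_eqF.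
have FNpi2 : F (- (pi / 2)) = -2 by rewrite /F sinN sin_pihalf mulrN1.
have Fpi2 : F (pi / 2) = 2 by rewrite /F sin_pihalf mulr1.
transitivity (\int[leb]_(x in `[F (- (pi / 2)), F (pi / 2)])
    (semicircle_pdf x)%:E)%E.
  rewrite FNpi2 Fpi2 [RHS]integral_mkcond; apply: eq_integral => x _.
  rewrite patchE; case: ifPn => // /negP; rewrite inE/= => x2.
  by rewrite semicircle_pdf0.
rewrite (integration_by_substitution_increasing (F := F)); first last.
- by apply: continuous_subspaceT => x; exact: continuous_semicircle_pdf.
- exact: derivable_LR is_derive_F.
- by rewrite F'E; apply/cvg_ex; exists (2 * cos (pi / 2));
    exact/cvg_at_left_filter/continuousF'.
- by rewrite F'E; apply/cvg_ex; exists (2 * cos (- (pi / 2)));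
    exact/cvg_at_right_filter/continuousF'.
- by move=> x _; rewrite F'E; exact: continuousF'.
- by move=> x y xpi ypi xy; rewrite /F ltr_pM2l// ltr_sin.
- lra.
transitivity (\int[leb]_(x in `[(- (pi / 2))%R, (pi / 2)%R])
    (2 / pi * cos x ^+ 2)%:E)%E.
  apply: eq_integral => x; rewrite inE/= => xpi; congr (_%:E).
  rewrite F'E; transitivity (semicircle_pdf (F x) * (2 * cos x)) => //.
  have c0 : 0 <= cos x by apply: cos_ge0_pihalf; rewrite in_itv/= in xpi.
  rewrite /semicircle_pdf.
  have -> : Num.max (4 - F x ^+ 2) 0 = (2 * cos x) ^+ 2.
    have e : 4 - F x ^+ 2 = (2 * cos x) ^+ 2.
      by rewrite /F !exprMn cos2sin2; ring.
    by rewrite e max_l// sqr_ge0.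
  rewrite sqrtr_sqr ger0_norm ?mulr_ge0//.
  by move: (cos x) (pi : R) pi_neq0 => c p p0; field.
rewrite (continuous_FTC2 (F := G)).
- rewrite -EFinB; congr (_%:E); rewrite /G cosN cos_pihalf !mulr0 !addr0.
  by move: (pi : R) pi_neq0 => p p0; field.
- lra.
- by apply: continuous_subspaceT => x; exact: continuousG'.
- exact: derivable_LR is_derive_G.
- by move=> x _; rewrite G'E.
Qed.

Let semicircle0 : semicircle_prob set0 = 0%E.
Proof. by rewrite /semicircle_prob integral_set0. Qed.

Let semicircle_ge0 A : (0 <= semicircle_prob A)%E.
Proof. by apply: integral_ge0 => x _; rewrite lee_fin semicircle_pdf_ge0. Qed.

Let semicircle_sigma_additive : semi_sigma_additive semicircle_prob.
Proof.
move=> /= A mA tA mUA; rewrite /semicircle_prob/= ge0_integral_bigcup//=.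
- apply: is_cvg_ereal_nneg_natsum_cond => n _ _.
  by apply: integral_ge0 => /= x _; rewrite lee_fin semicircle_pdf_ge0.
- apply/measurable_EFinP; apply: measurable_funTS.
  exact: measurable_semicircle_pdf.
- by move=> x _; rewrite lee_fin semicircle_pdf_ge0.
Qed.

HB.instance Definition _ := isMeasure.Build _ _ _
  semicircle_prob semicircle0 semicircle_ge0 semicircle_sigma_additive.

Let semicircle_setT : semicircle_prob [set: _] = 1%E.
Proof. exact: integral_semicircle_pdf. Qed.

HB.instance Definition _ :=
  @Measure_isProbability.Build _ _ R semicircle_prob semicircle_setT.

End semicircle.

Section log_energy_and_wasserstein.
Context {R : realType}.
Local Notation bR := (measurableTypeR R).

Definition P2 : set (probability bR R) :=
  [set mu : probability bR R | (\int[mu]_x (x ^+ 2)%:E < +oo)%E].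

Definition S01 : set (probability bR R) :=
  [set rho : probability bR R | [/\ P2 rho,
    (\int[rho]_x x%:E = 0)%E & (\int[rho]_x (x ^+ 2)%:E = 1)%E]].

Definition coupling (mu nu : probability bR R) :
    set (probability (bR * bR)%type R) :=
  [set g : probability (bR * bR)%type R |
    (forall A, measurable A -> pushforward g fst A = mu A) /\
    (forall A, measurable A -> pushforward g snd A = nu A)].

(* On [P2] the infimum is finite (take the product coupling), so [fine] is
   harmless there. *)
Definition W2 (mu nu : probability bR R) : R :=
  Num.sqrt (fine (ereal_inf
    [set (\int[g]_z (`|z.1 - z.2| ^+ 2)%:E)%E | g in coupling mu nu])).

(* [lne] is the extended logarithm, with [lne 0 = -oo] (unlike [ln 0 = 0]).
   On [P2] the positive part of the logarithm is integrable and the second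
   moment is finite, so no [+oo - +oo] arises and the value is in ]-oo, +oo]. *)
Definition Ilog (mu : probability bR R) : \bar R :=
  (- (\int[mu]_y \int[mu]_x lne `|x - y|%:E)
   + 2^-1%:E * (\int[mu]_x (x ^+ 2)%:E) - (3 / 4)%:E)%E.

End log_energy_and_wasserstein.

(* Main.v *)
(* Let [T] be the monotone map pushing the semicircle law [sigma] to [mu], and
   [rho = int x T(x) d sigma = cos t].  Both laws have second moment 1, so
   [W2 ^ 2 <= 2 - 2 rho = (2 sin (t / 2)) ^ 2] and it suffices to bound
   [int int log |T x - T y|] by [- 1/4 - t ^ 2 / 2].  Put
   [q = (T x - T y) / (x - y) >= 0].  Along the great circle
   [s |-> cos s + k sin s], which runs from [1] at [s = 0] to [q] at [s = t]
   when [k = (q - cos t) / sin t], the logarithm has second derivative at most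
   [-1]; hence [log q <= (t / sin t) (q - cos t) - t ^ 2 / 2].  Integrating, the
   claim follows from [int int log |x - y| = - 1/4] (only [<=] is needed) and
   [int int q <= rho] for the semicircle law.  Both come from Chebyshev expansions
   regularised by a radius [r < 1]: the first from that of [log |x - y|], and the
   second from that of [1 / (x - y)], letting [r] tend to [1] with Fatou's lemma.
   The pair [(x, T x)] is realised by quantile functions of a uniform variable. *)
Require Import Defs.
From HB Require Import structures.
From mathcomp Require Import all_boot all_order all_algebra.
From mathcomp Require Import all_classical all_reals all_analysis.
From mathcomp Require Import measurable_realfun ring lra.
Import Order.TTheory GRing.Theory Num.Theory.
Import numFieldNormedType.Exports.
Set Implicit Arguments.
Unset Strict Implicit.
Unset Printing Implicit Defensive.
Local Open Scope classical_set_scope.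
Local Open Scope ring_scope.

(** * Concavity of the logarithm along great circles *)

Section sphere.
Context {R : realType}.
Implicit Types k s t : R.

Lemma ger0_is_derive1_le (f g : R -> R) (a b : R) : a <= b ->
  (forall s, a <= s <= b -> is_derive s 1 f (g s)) ->
  (forall s, a <= s <= b -> 0 <= g s) -> f a <= f b.
Proof.
move=> ab df g0.
apply: (@ger0_derive1_ndecr R f a b) => //.
- move=> x; rewrite in_itv/= => /andP[ax xb].
  by case: (df x _) => //; rewrite !ltW.
- move=> x; rewrite in_itv/= => /andP[ax xb].
  have axb : a <= x <= b by rewrite !ltW.
  by rewrite derive1E; case: (df x axb) => _ ->; exact: g0.
- apply: derivable_within_continuous => x; rewrite in_itv/= => axb.
  by case: (df x axb).
Qed.

Let v k s := cos s + k * sin s.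

Let is_derive_v k s : is_derive s 1 (v k) (k * cos s - sin s).
Proof.
rewrite /v; apply: is_derive_eq.
by rewrite /GRing.scale/=; ring.
Qed.

Let is_derive_dv k s : is_derive s 1 (fun s => k * cos s - sin s) (- v k s).
Proof.
rewrite /v; apply: is_derive_eq.
by rewrite /GRing.scale/=; ring.
Qed.

(** Since [v'' = - v], the gap [h s = k * s - s ^ 2 / 2 - ln (v k s)] has [h'' = (v' / v) ^ 2 >= 0],
    while [h] and [h'] vanish at 0; so [h] is nonnegative up to [t]. *)
Lemma ln_cos_sin_le k t : 0 <= t <= pi / 2 -> 0 < cos t + k * sin t ->
  ln (cos t + k * sin t) <= k * t - t ^+ 2 / 2.
Proof.
move=> /andP[t0 tpi2] vt0.
have [->|t_neq0] := eqVneq t 0.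
  by rewrite cos0 sin0 !mulr0 addr0 ln1 expr0n/= mul0r subr0.
have tgt0 : 0 < t by rewrite lt_neqAle eq_sym t_neq0.
have pi0 := pi_gt0 R.
have sin_gt0 s : 0 < s <= t -> 0 < sin s.
  by move=> /andP[s0 st]; apply: sin_gt0_pi; rewrite s0/=; lra.
(* On [[0, t]], [v k s] is a combination of its end values 1 and [v k t] with the nonnegative
   weights [sin (t - s) / sin t] and [sin s / sin t], hence positive. *)
have v_gt0 s : 0 <= s <= t -> 0 < v k s.
  move=> /andP[s0 st].
  rewrite -(pmulr_rgt0 _ (sin_gt0 t _)); last by rewrite tgt0/=.
  have -> : sin t * v k s = sin (t - s) + (cos t + k * sin t) * sin s.
    by rewrite sinB /v; ring.
  have [->|s_neq0] := eqVneq s 0.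
    by rewrite subr0 sin0 mulr0 addr0 sin_gt0// tgt0/=.
  have sgt0 : 0 < s by rewrite lt_neqAle eq_sym s_neq0.
  apply: ltr_wpDl; last by rewrite mulr_gt0// sin_gt0// sgt0.
  by apply: sin_ge0_pi; apply/andP; split; lra.
pose w s := k - s - (k * cos s - sin s) / v k s.
pose h s := k * s - s ^+ 2 / 2 - ln (v k s).
have dw s : 0 <= s <= t -> is_derive s 1 w (((k * cos s - sin s) / v k s) ^+ 2).
  move=> /v_gt0 vs0.
  have dv := is_derive_v k s.
  have ddv := is_derive_dv k s.
  have vV : is_derive s 1 (fun s => (v k s)^-1)
     (- (v k s) ^- 2 *: (k * cos s - sin s)).
    by apply: is_deriveV; rewrite gt_eqF.
  rewrite /w; apply: is_derive_eq.
  rewrite /GRing.scale/=.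
  by move: (v k s) vs0 (k * cos s - sin s) => V V0 D; field; rewrite gt_eqF.
have dh s : 0 <= s <= t -> is_derive s 1 h (w s).
  move=> /v_gt0 vs0.
  have dv := is_derive_v k s.
  have dln : is_derive s 1 (@ln R \o v k) ((v k s)^-1 * (k * cos s - sin s)).
    by apply: is_derive1_comp; exact: is_derive1_ln.
  rewrite /h; apply: is_derive_eq.
  by rewrite /w /GRing.scale/=; field; rewrite gt_eqF.
have w0 : w 0 = 0 by rewrite /w /v cos0 sin0; field.
have h0 : h 0 = 0 by rewrite /h /v cos0 sin0 mulr0 addr0 ln1; ring.
have w_ge0 s : 0 <= s <= t -> 0 <= w s.
  move=> /andP[s0 st]; rewrite -w0; apply: (@ger0_is_derive1_le w (fun s => ((k * cos s - sin s) / v k s) ^+ 2) 0 s s0).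
    by move=> x /andP[x0 xs]; apply: dw; rewrite x0 (le_trans xs).
  by move=> x _; exact: sqr_ge0.
have : h 0 <= h t by exact: (@ger0_is_derive1_le h w 0 t t0 dh w_ge0).
by rewrite h0 /h /v subr_ge0.
Qed.

(** With [t = acos rho], the slope is [c = t / sin t], obtained from [k = (q - rho) / sin t]; at
    [rho = 1] it degenerates to 1 and the bound is [ln q <= q - 1]. The slope does not depend on
    [q], so the inequality can be integrated, and its sign lets an upper bound on the mean of [q] be
    inserted. *)
Lemma ln_le_acos (rho : R) : 0 <= rho <= 1 ->
  exists2 c : R, 0 <= c & forall q : R, 0 < q ->
    ln q <= c * (q - rho) - acos rho ^+ 2 / 2.
Proof.
move=> /andP[rho0 rho1].
have rhoI : -1 <= rho <= 1 by rewrite rho1 (le_trans _ rho0)// lerN10.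
have pi0 := pi_gt0 R.
have [rhoE|rho_neq1] := eqVneq rho 1.
  exists 1 => // q q0; rewrite rhoE acos1 expr0n/= mul0r subr0 mul1r.
  have := @le_ln1Dx R (q - 1).
  rewrite (_ : 1 + (q - 1) = q); last by ring.
  by apply; rewrite ltrBrDr addNr.
set t := acos rho.
have ct : cos t = rho by rewrite acosK// in_itv.
have t0 : 0 < t by apply: acos_gt0; rewrite lt_neqAle rho_neq1 rho1 (andP rhoI).1.
have tpi : t <= pi / 2.
  rewrite leNgt; apply/negP => pit.
  have : cos t < cos (pi / 2).
    rewrite ltr_cos ?in_itv/=// ?acos_ge0 ?acos_lepi//.
    by rewrite divr_ge0 ?pi_ge0//=; lra.
  by rewrite cos_pihalf ct ltNge rho0.
have st : 0 < sin t by apply: sin_gt0_pi; rewrite t0/=; lra.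
exists (t / sin t); first by rewrite divr_ge0// ltW.
move=> q q0.
have qE : q = cos t + (q - rho) / sin t * sin t.
  by rewrite divfK ?gt_eqF// ct addrC subrK.
rewrite [in leLHS]qE (_ : t / sin t * (q - rho) = (q - rho) / sin t * t); last by ring.
by apply: ln_cos_sin_le; [rewrite (ltW t0)|rewrite -qE].
Qed.

End sphere.

(** * Chebyshev polynomials rescaled to [-2, 2], and generating functions of their products *)

Section chebyshev.
Context {R : realType}.
Implicit Types (x y r s : R) (n N : nat).

(** Keeping the initial values as parameters lets the recurrence for products be proved once for
    both kinds of polynomials. *)
Fixpoint chebyshev_rec (a b x : R) (n : nat) : R :=
  match n with
  | 0 => a
  | 1 => b
  | (n'.+1 as m).+1 => x * chebyshev_rec a b x m - chebyshev_rec a b x n'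
  end.

(* [chebT x n] is [T_n (x / 2)] and [chebU x n] is [U_(n-1) (x / 2)]. *)
Definition chebT x := chebyshev_rec 1 (x / 2) x.
Definition chebU x := chebyshev_rec 0 1 x.

Lemma chebyshev_recSS a b x n : chebyshev_rec a b x n.+2 =
  x * chebyshev_rec a b x n.+1 - chebyshev_rec a b x n.
Proof. by []. Qed.

Lemma nat_ind2 (P : nat -> Prop) :
  P 0%N -> P 1%N -> (forall n, P n -> P n.+1 -> P n.+2) -> forall n, P n.
Proof.
move=> P0 P1 PS n; suff : P n /\ P n.+1 by case.
by elim: n => [//|n [Pn PSn]]; split => //; exact: PS.
Qed.

Lemma chebT_cos a n : chebT (2 * cos a) n = cos (n%:R * a).
Proof.
rewrite /chebT; elim/nat_ind2: n => [|| n IH0 IH1].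
- by rewrite /= mul0r cos0.
- by rewrite /= mul1r mulrC mulKf.
- rewrite chebyshev_recSS IH0 IH1.
  have -> : n.+2%:R * a = n.+1%:R * a + a by rewrite -natr1 mulrDl mul1r.
  have -> : n%:R * a = n.+1%:R * a - a by rewrite -natr1 mulrDl mul1r addrK.
  by rewrite !cosD cosN sinN; ring.
Qed.

Lemma chebU_sin a n : chebU (2 * cos a) n * sin a = sin (n%:R * a).
Proof.
rewrite /chebU; elim/nat_ind2: n => [|| n IH0 IH1].
- by rewrite /= !mul0r sin0.
- by rewrite /= !mul1r.
- rewrite chebyshev_recSS mulrBl IH0 -(mulrA (2 * cos a)) IH1.
  have -> : n.+2%:R * a = n.+1%:R * a + a by rewrite -natr1 mulrDl mul1r.
  have -> : n%:R * a = n.+1%:R * a - a by rewrite -natr1 mulrDl mul1r addrK.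
  by rewrite !sinD cosN sinN; ring.
Qed.

(** The addition formula for [sin (n a + a)] divided by [sin a]. Proved from the recurrence, it also
    holds where [sin a = 0], and so bounds [chebU] up to the end points. *)
Lemma chebU_chebT x n : chebU x n.+1 = x / 2 * chebU x n + chebT x n.
Proof.
elim/nat_ind2: n => [|| n IH0 IH1].
- by rewrite /chebU /chebT /=; ring.
- by rewrite /chebU /chebT /=; field.
- have TE0 : chebT x n = chebU x n.+1 - x / 2 * chebU x n by rewrite IH0; ring.
  have TE1 : chebT x n.+1 = chebU x n.+2 - x / 2 * chebU x n.+1 by rewrite IH1; ring.
  rewrite [chebT x n.+2]chebyshev_recSS -!/(chebT x _) TE0 TE1.
  have UE : chebU x n.+2 = x * chebU x n.+1 - chebU x n by [].
  by rewrite [chebU x n.+3]chebyshev_recSS -!/(chebU x _) UE; field.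
Qed.

Lemma chebT_chebU x n : chebT x n.+1 = (chebU x n.+2 - chebU x n) / 2.
Proof.
have -> : chebT x n.+1 = chebU x n.+2 - x / 2 * chebU x n.+1.
  by rewrite [chebU x n.+2]chebU_chebT; ring.
by rewrite [chebU x n.+2]chebyshev_recSS -!/(chebU x _); field.
Qed.

Lemma norm2_cos x : `|x| <= 2 -> x = 2 * cos (acos (x / 2)).
Proof.
rewrite ler_norml => /andP[x2 x2'].
by rewrite acosK ?in_itv/=; [field|apply/andP; split; lra].
Qed.

Lemma chebT_le1 x n : `|x| <= 2 -> `|chebT x n| <= 1.
Proof. by move=> /norm2_cos ->; rewrite chebT_cos ler_norml cos_geN1 cos_le1. Qed.

Lemma chebU_len x n : `|x| <= 2 -> `|chebU x n| <= n%:R.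
Proof.
move=> x2; elim: n => [|n IH]; first by rewrite normr0.
rewrite chebU_chebT -[n.+1%:R]natr1; apply: le_trans (ler_normD _ _) _.
apply: lerD; last exact: chebT_le1.
rewrite normrM (le_trans _ IH)// ler_piMl// normrM [`|2^-1|]ger0_norm//.
by rewrite ler_pdivrMr// mul1r.
Qed.

(* The reciprocal polynomial of the recurrence satisfied by products of two
   solutions; for [x = 2 cos a] and [y = 2 cos b] it is the product of
   [1 - 2 r cos (a + b) + r ^ 2] and [1 - 2 r cos (a - b) + r ^ 2]. *)
Definition cheb_den x y r :=
  1 - x * y * r + (x ^+ 2 + y ^+ 2 - 2) * r ^+ 2 - x * y * r ^+ 3 + r ^+ 4.

Lemma cheb_denE x y r : cheb_den x y r =
  (1 - r ^+ 2) ^+ 2 + r ^+ 2 * (x - y) ^+ 2 - r * (1 - r) ^+ 2 * (x * y).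
Proof. by rewrite /cheb_den; ring. Qed.

Lemma cheb_denC x y r : cheb_den x y r = cheb_den y x r.
Proof. by rewrite /cheb_den; ring. Qed.

Lemma norm2_mul x y : `|x| <= 2 -> `|y| <= 2 -> `|x * y| <= 4.
Proof.
move=> x2 y2; rewrite normrM (_ : 4 = 2 * 2); last by ring.
by rewrite ler_pM.
Qed.

(** Replacing [x * y] by its maximum 4 in [cheb_denE] leaves exactly [(1 - r) ^ 4]. That term keeps
    the denominator away from 0 uniformly in [x] and [y]; the other compares it with
    [(x - y) ^ 2]. *)
Lemma cheb_den_ge_sqr x y r : `|x| <= 2 -> `|y| <= 2 -> 0 <= r <= 1 ->
  (1 - r) ^+ 4 + r ^+ 2 * (x - y) ^+ 2 <= cheb_den x y r.
Proof.
move=> x2 y2 /andP[r0 r1].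
have := norm2_mul x2 y2; rewrite ler_norml => /andP[_ xy4].
rewrite cheb_denE addrAC lerD2r.
have : r * (1 - r) ^+ 2 * (x * y) <= r * (1 - r) ^+ 2 * 4.
  by rewrite ler_wpM2l// mulr_ge0// sqr_ge0.
have -> : (1 - r) ^+ 4 = (1 - r ^+ 2) ^+ 2 - r * (1 - r) ^+ 2 * 4 by ring.
lra.
Qed.

Lemma cheb_den_ge x y r : `|x| <= 2 -> `|y| <= 2 -> 0 <= r <= 1 ->
  (1 - r) ^+ 4 <= cheb_den x y r.
Proof.
move=> x2 y2 r01; apply: le_trans (cheb_den_ge_sqr x2 y2 r01).
by rewrite lerDl mulr_ge0// sqr_ge0.
Qed.

Lemma cheb_den_gt0 x y r : `|x| <= 2 -> `|y| <= 2 -> 0 <= r < 1 ->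
  0 < cheb_den x y r.
Proof.
move=> x2 y2 /andP[r0 r1].
apply: lt_le_trans (cheb_den_ge x2 y2 _); last by rewrite r0 ltW.
by rewrite exprn_gt0// subr_gt0.
Qed.

Section generating_function.
Variables (x y : R) (a : nat -> R).
Hypothesis aE : forall n, a n.+4 = x * y * a n.+3
  - (x ^+ 2 + y ^+ 2 - 2) * a n.+2 + x * y * a n.+1 - a n.

(** The numerator, over [cheb_den x y r], of the generating function of the shifted sequence
    [n |-> a (n + N)]: at [N = 0] it gives the whole series, at larger [N] the remainder. *)
Definition cheb_tail r N :=
  (1 - x * y * r + (x ^+ 2 + y ^+ 2 - 2) * r ^+ 2 - x * y * r ^+ 3) * a N
  + (r - x * y * r ^+ 2 + (x ^+ 2 + y ^+ 2 - 2) * r ^+ 3) * a N.+1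
  + (r ^+ 2 - x * y * r ^+ 3) * a N.+2 + r ^+ 3 * a N.+3.

Lemma cheb_den_sum r N :
  cheb_den x y r * (\sum_(n < N) r ^+ n * a n) =
  cheb_tail r 0 - r ^+ N * cheb_tail r N.
Proof.
elim: N => [|N IH]; first by rewrite big_ord0 mulr0 expr0 mul1r subrr.
rewrite big_ord_recr/= mulrDr IH /cheb_tail aE /cheb_den [r ^+ N.+1]exprS.
by move: (r ^+ N) => z; ring.
Qed.

Lemma cheb_tail_le r N M : `|x| <= 2 -> `|y| <= 2 -> 0 <= r <= 1 ->
  (forall n, (n < 4)%N -> `|a (n + N)%N| <= M) -> `|cheb_tail r N| <= 32 * M.
Proof.
move=> x2 y2 /andP[r0 r1] aM.
have xy4 := norm2_mul x2 y2.
have e6 : `|x ^+ 2 + y ^+ 2 - 2| <= 6.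
  have s2 (z : R) : `|z| <= 2 -> 0 <= z ^+ 2 <= 4.
    move=> z2; rewrite sqr_ge0/= -real_normK ?num_real//.
    have z0 : 0 <= `|z| by []; nra.
  have /andP[? ?] := s2 x x2; have /andP[? ?] := s2 y y2.
  by rewrite ler_norml; apply/andP; split; lra.
have M0 : 0 <= M by apply: le_trans (aM 0%N _).
have rk k : `|r ^+ k| <= 1 by rewrite ger0_norm ?exprn_ge0// exprn_ile1.
have mulrk (w K : R) k : `|w| <= K -> `|w * r ^+ k| <= K.
  by move=> wK; rewrite normrM (le_trans _ wK)// ler_piMr.
have mulM (w z K : R) : `|w| <= K -> `|z| <= M -> `|w * z| <= K * M.
  by move=> wK zM; rewrite normrM ler_pM.
have addM (u w K L : R) : `|u| <= K -> `|w| <= L -> `|u + w| <= K + L.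
  by move=> uK wL; apply: le_trans (ler_normD _ _) _; exact: lerD.
have subM (u w K L : R) : `|u| <= K -> `|w| <= L -> `|u - w| <= K + L.
  by move=> uK wL; apply: le_trans (ler_normB _ _) _; exact: lerD.
have r1' : `|r| <= 1 := rk 1%N.
have xyr k := mulrk _ _ k xy4; have er k := mulrk _ _ k e6.
(* The four coefficients are bounded termwise, using 1 for powers of [r], 4 for [x * y] and 6 for
   [x ^ 2 + y ^ 2 - 2]; the bounds 15, 11, 5 and 1 add up to 32. *)
rewrite /cheb_tail (_ : 32 * M = (1 + 4 + 6 + 4) * M + (1 + 4 + 6) * M
  + (1 + 4) * M + 1 * M); last by ring.
apply: (addM); last exact: (mulM _ _ _ (rk 3%N) (aM 3%N isT)).
apply: (addM); last first.
  exact: (mulM _ _ _ (subM _ _ _ _ (rk 2%N) (xyr 3%N)) (aM 2%N isT)).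
apply: (addM); last first.
  apply: (mulM _ _ _ _ (aM 1%N isT)); apply: (addM) (er 3%N).
  exact: (subM _ _ _ _ r1' (xyr 2%N)).
apply: (mulM _ _ _ _ (aM 0%N isT)); apply: (subM) (xyr 3%N).
apply: (addM) (er 2%N); apply: (subM) (xyr 1%N).
by rewrite normr1.
Qed.

End generating_function.

Lemma chebyshev_rec_mul a b a' b' x y n :
  let p n := chebyshev_rec a b x n * chebyshev_rec a' b' y n in
  p n.+4 = x * y * p n.+3 - (x ^+ 2 + y ^+ 2 - 2) * p n.+2
    + x * y * p n.+1 - p n.
Proof. by move=> p; rewrite /p !chebyshev_recSS; ring. Qed.

End chebyshev.

(** * Truncated and regularised expansion of [ln |x - y|] *)

Section log_bound.
Context {R : realType}.
Implicit Types (x y r s : R) (n N : nat).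

Lemma is_derive_sum_expr (d : nat -> R) N s :
  is_derive s 1 (fun s => \sum_(n < N) s ^+ n.+1 * d n / n.+1%:R)
    (\sum_(n < N) s ^+ n * d n).
Proof.
elim: N => [|N IH].
  under eq_fun do rewrite big_ord0.
  by rewrite big_ord0; exact: is_derive_cst.
under eq_fun do rewrite big_ord_recr/=.
rewrite big_ord_recr/=.
have dN : is_derive s 1 (fun s => s ^+ N.+1 * d N / N.+1%:R) (s ^+ N * d N).
  have dX : is_derive s 1 (fun s : R => s ^+ N.+1) (N.+1%:R * s ^+ N).
    have -> : N.+1%:R * s ^+ N = (N.+1%:R * s ^+ N) *: (1 : R^o).
      by rewrite /GRing.scale/= mulr1.
    have := @is_deriveX R R^o (fun s : R => s) N.+1 s 1 1 (is_derive_id _ _).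
    by rewrite exprfctE.
  have := @is_deriveZ R R^o R^o (fun s : R => s ^+ N.+1) (d N / N.+1%:R) s 1 _ dX.
  congr is_derive.
    by apply/funext => z; rewrite /GRing.scale/=; rewrite [LHS]mulrC mulrA.
  rewrite /GRing.scale/=.
 by rewrite mulrA divfK ?pnatr_eq0// mulrC.
exact: (is_deriveD IH dN).
Qed.

(** As a power series in [s], [ln (cheb_den x y s)] is -4 times the sum of [s ^ n * T_n * T_n / n]
    over [n >= 1]. The truncation error vanishes at [s = 0] and its derivative is a tail bounded by
    [K], so it is at most [K] at [s = r]. There [cheb_den] dominates [r ^ 2 * (x - y) ^ 2], whence
    the term [- ln r]. *)
Lemma ln_norm_le_chebT x y r N : `|x| <= 2 -> `|y| <= 2 -> x != y ->
  0 < r < 1 ->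
  ln `|x - y| <= - ln r - 2 * (\sum_(n < N)
     r ^+ n.+1 * (chebT x n.+1 * chebT y n.+1) / n.+1%:R) +
     64 * r ^+ N / (1 - r) ^+ 4.
Proof.
move=> x2 y2 xy /andP[r0 r1].
pose d n := chebT x n.+1 * chebT y n.+1.
have dE n : d n.+4 = x * y * d n.+3
  - (x ^+ 2 + y ^+ 2 - 2) * d n.+2 + x * y * d n.+1 - d n.
  exact: chebyshev_rec_mul.
(* 128 is 4 times the 32 of [cheb_tail_le], the products of [chebT] being bounded by 1. *)
pose K := 128 * r ^+ N / (1 - r) ^+ 4.
have K0 : 0 <= K.
  apply: divr_ge0; first by apply: mulr_ge0 => //; rewrite exprn_ge0// ltW.
  by rewrite exprn_ge0// subr_ge0 ltW.
pose S s := \sum_(n < N) s ^+ n.+1 * d n / n.+1%:R.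
pose f s := K * s - (4 * S s + ln (cheb_den x y s)).
pose E' s := - (x * y) + 2 * (x ^+ 2 + y ^+ 2 - 2) * s - 3 * (x * y) * s ^+ 2
  + 4 * s ^+ 3.
(* The derivative of [cheb_den] is -4 times the numerator of the generating function of [d], so in
   [f'] only the remainder at [N] survives. *)
have tail0 s : E' s + 4 * cheb_tail x y d s 0 = 0.
  by rewrite /E' /cheb_tail /d /chebT /=; field.
have dE' s : is_derive s 1 (cheb_den x y) (E' s).
  rewrite /cheb_den; apply: is_derive_eq.
  by rewrite /GRing.scale/= /E'; ring.
have E0 s : 0 <= s <= r -> 0 < cheb_den x y s.
  by move=> /andP[s0 sr]; apply: cheb_den_gt0; rewrite // s0 (le_lt_trans sr).
have df s : 0 <= s <= r -> is_derive s 1 f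
    (K - (4 * (\sum_(n < N) s ^+ n * d n) + (cheb_den x y s)^-1 * E' s)).
  move=> sr.
  have dln : is_derive s 1 (@ln R \o cheb_den x y) ((cheb_den x y s)^-1 * E' s).
    by apply: is_derive1_comp; apply: is_derive1_ln; exact: E0.
  have dS := is_derive_sum_expr d N s.
  rewrite /f /S; apply: is_derive_eq.
  by rewrite /GRing.scale/=; ring.
have f'_ge0 s : 0 <= s <= r ->
    0 <= K - (4 * (\sum_(n < N) s ^+ n * d n) + (cheb_den x y s)^-1 * E' s).
  move=> /[dup] /E0 Es /andP[s0 sr].
  rewrite subr_ge0.
  have -> : 4 * (\sum_(n < N) s ^+ n * d n) + (cheb_den x y s)^-1 * E' s =
      - 4 * s ^+ N * cheb_tail x y d s N / cheb_den x y s.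
    have := cheb_den_sum dE s N; have := tail0 s.
    move: (cheb_tail x y d s 0) (cheb_tail x y d s N) (\sum_(n < N) _) => T0 TN Sg.
    move=> T0E SE; apply: (mulfI (lt0r_neq0 Es)).
    rewrite mulrDr mulrCA SE mulrA divff ?mul1r; last by rewrite lt0r_neq0.
    rewrite [RHS]mulrC divfK ?lt0r_neq0//.
    by move: T0E; lra.
  apply: le_trans (ler_norm _) _.
  rewrite normrM normfV (gtr0_norm Es) /K.
  rewrite ler_pM ?invr_ge0 ?(ltW Es)//; last first.
    rewrite lef_pV2 ?posrE// ?exprn_gt0 ?subr_gt0//.
    apply: le_trans (cheb_den_ge x2 y2 _); last by rewrite s0 ltW// (le_lt_trans sr).
    by apply: lerXn2r; rewrite ?nnegrE; lra.
  rewrite !normrM (_ : `|-4 : R| = 4); last by rewrite normrN ger0_norm.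
  rewrite (ger0_norm (exprn_ge0 _ s0)) (_ : 128 * r ^+ N = 4 * r ^+ N * (32 * 1)); last by ring.
  apply: ler_pM; rewrite ?mulr_ge0 ?exprn_ge0//.
    by rewrite ler_pM2l// lerXn2r ?nnegrE// ltW.
  apply: cheb_tail_le => // [|n _]; first by rewrite s0 ltW// (le_lt_trans sr).
  by rewrite normrM mulr_ile1 ?chebT_le1.
have fle : f 0 <= f r.
  by apply: (@ger0_is_derive1_le _ f _ 0 r (ltW r0) df f'_ge0).
have f0 : f 0 = 0.
  rewrite /f /S mulr0 big1 => [|n _]; last by rewrite expr0n/= !mul0r.
  by rewrite /cheb_den !expr0n/= !mulr0 !subr0 !addr0 ln1 addr0 subr0.
have Kr : K * r <= K by rewrite ler_piMr// ltW.
have lnE : ln `|x - y| + ln `|x - y| + (ln r + ln r) <= ln (cheb_den x y r).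
  have xy0 : 0 < `|x - y| by rewrite normr_gt0 subr_eq0.
  rewrite -!mulr2n -!lnXn// -lnM ?posrE ?exprn_gt0// ler_ln ?posrE ?mulr_gt0 ?exprn_gt0//;
    last by apply: E0; rewrite lexx ltW.
  rewrite real_normK ?num_real//.
  apply: le_trans (cheb_den_ge_sqr x2 y2 _); last by rewrite !ltW.
  by rewrite [leLHS]mulrC lerDr exprn_ge0// subr_ge0 ltW.
have KE : 64 * r ^+ N / (1 - r) ^+ 4 = K / 2 by rewrite /K; field; rewrite subr_eq0 gt_eqF.
rewrite KE -[X in _ - 2 * X]/(S r).
move: fle lnE Kr; rewrite f0 /f.
move: (S r) (ln (cheb_den x y r)) (ln r) (ln `|x - y|) (K : R) (K * r).
by move=> *; lra.
Qed.

End log_bound.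

(* With [x = 2 cos a], [w = r e^(i a)] and [z_x = w + 1 / w], the kernel is the
   antisymmetric part in [(x, y)] of the real part of [1 / (z_x - y)]. *)
Section kernel.
Context {R : realType}.
Implicit Types (x y r s : R) (n N : nat).

Definition cheb_ker r x y := r * (1 + r) ^+ 2 * (x - y) / (4 * cheb_den x y r).

Lemma cheb_kerC r x y : cheb_ker r y x = - cheb_ker r x y.
Proof. by rewrite /cheb_ker cheb_denC -mulNr -mulrN opprB. Qed.

Lemma cheb_ker_mul_ge0 r x y d : `|x| <= 2 -> `|y| <= 2 -> 0 <= r < 1 ->
  0 <= d * (x - y) -> 0 <= d * cheb_ker r x y.
Proof.
move=> x2 y2 r01 dxy; have /andP[r0 r1] := r01.
rewrite /cheb_ker mulrA divr_ge0//; last first.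
  by rewrite mulr_ge0// ltW// cheb_den_gt0.
by rewrite mulrCA mulr_ge0// mulr_ge0// sqr_ge0.
Qed.

Lemma cheb_ker_le r x y : `|x| <= 2 -> `|y| <= 2 -> 0 <= r < 1 ->
  `|cheb_ker r x y| <= 4 / (1 - r) ^+ 4.
Proof.
move=> x2 y2 r01; have /andP[r0 r1] := r01.
have E0 := cheb_den_gt0 x2 y2 r01.
have r4 : 0 < (1 - r) ^+ 4 by rewrite exprn_gt0// subr_gt0.
rewrite /cheb_ker normrM normfV [`|4 * _|]gtr0_norm ?mulr_gt0//.
have -> : 4 / (1 - r) ^+ 4 = 16 * (4 * (1 - r) ^+ 4)^-1.
  by field; rewrite subr_eq0 gt_eqF.
apply: ler_pM; rewrite ?invr_ge0 ?mulr_ge0 ?(ltW E0)//; last first.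
  have r1E : (1 - r) ^+ 4 <= cheb_den x y r by apply: cheb_den_ge; rewrite // r0 ltW.
  by rewrite lef_pV2 ?posrE ?ler_pM2l// mulr_gt0.
have r2 : (1 + r) ^+ 2 <= 2 ^+ 2 by apply: lerXn2r; rewrite ?nnegrE; lra.
have num0 : 0 <= r * (1 + r) ^+ 2 by rewrite mulr_ge0// sqr_ge0.
rewrite normrM (ger0_norm num0).
have xy4 : `|x - y| <= 4 by apply: le_trans (ler_normB _ _) _; lra.
rewrite (_ : 16 = 1 * 2 ^+ 2 * 4); last by ring.
by do 2 (apply: ler_pM => //); rewrite ?sqr_ge0// ltW.
Qed.

(** The antisymmetrised products obey the same fourth-order recurrence, and their [cheb_tail] at 0
    is the numerator of the kernel. In the remainder at [N] the largest index is [N + 3], which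
    bounds each term because [chebU] grows at most linearly. *)
Lemma cheb_ker_sum r x y N : `|x| <= 2 -> `|y| <= 2 -> 0 <= r < 1 ->
  `|cheb_ker r x y - \sum_(n < N) r ^+ n *
     ((chebT x n * chebU y n - chebU x n * chebT y n) / 2)| <=
  32 * (N.+3%:R * r ^+ N) / (1 - r) ^+ 4.
Proof.
move=> x2 y2 r01; have /andP[r0 r1] := r01.
pose a n := (chebT x n * chebU y n - chebU x n * chebT y n) / 2.
have aE n : a n.+4 = x * y * a n.+3
  - (x ^+ 2 + y ^+ 2 - 2) * a n.+2 + x * y * a n.+1 - a n.
  rewrite (_ : a n.+4 = (chebT x n.+4 * chebU y n.+4 - chebU x n.+4 * chebT y n.+4) / 2)//.
  rewrite [chebT x n.+4 * _]chebyshev_rec_mul [chebU x n.+4 * _]chebyshev_rec_mul.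
  rewrite -!/(chebT _ _) -!/(chebU _ _) /a.
  by ring.
have E0 := cheb_den_gt0 x2 y2 r01.
have tail0 : cheb_tail x y a r 0 = r * (1 + r) ^+ 2 * (x - y) / 4.
  by rewrite /cheb_tail /a /chebT /chebU /=; field.
have -> : cheb_ker r x y - \sum_(n < N) r ^+ n * a n =
    r ^+ N * cheb_tail x y a r N / cheb_den x y r.
  have := cheb_den_sum aE r N; rewrite tail0.
  move: (\sum_(n < N) _) (cheb_tail _ _ _ _ _) => Sg TN SE.
  apply: (mulfI (lt0r_neq0 E0)); rewrite mulrBr SE [RHS]mulrC divfK ?lt0r_neq0//.
  by rewrite /cheb_ker; field; rewrite lt0r_neq0.
rewrite normrM normfV (gtr0_norm E0).
rewrite ler_pM ?invr_ge0 ?(ltW E0)//; last first.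
  rewrite lef_pV2 ?posrE// ?exprn_gt0 ?subr_gt0//.
  by apply: (cheb_den_ge x2 y2); rewrite r0 ltW.
rewrite normrM (ger0_norm (exprn_ge0 _ r0)).
rewrite [leRHS](_ : _ = r ^+ N * (32 * N.+3%:R)); last by rewrite mulrA mulrC.
rewrite ler_wpM2l ?exprn_ge0//.
apply: cheb_tail_le => // [|n n4]; first by rewrite r0 ltW.
rewrite /a normrM [`|2^-1|]ger0_norm// ler_pdivrMr//.
apply: le_trans (ler_normB _ _) _.
have nN : (n + N)%:R <= N.+3%:R :> R by rewrite ler_nat addnC -[N.+3]addn3 leq_add2l.
rewrite mulr_natr mulr2n; apply: lerD; rewrite normrM.
  rewrite -[leRHS]mul1r; apply: ler_pM => //; first exact: chebT_le1.
  by apply: le_trans nN; exact: chebU_len.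
rewrite -[leRHS]mulr1; apply: ler_pM => //; last exact: chebT_le1.
by apply: le_trans nN; exact: chebU_len.
Qed.

End kernel.

(** * Integrability of bounded functions *)

Section probability_integrable.
Context d (T : measurableType d) (R : realType) (P : probability T R).

Lemma integrable_le (f : T -> R) M : measurable_fun setT f ->
  (forall x, `|f x| <= M) -> P.-integrable setT (EFin \o f).
Proof.
move=> mf fM; apply: measurable_bounded_integrable => //.
  by apply: le_lt_trans (probability_le1 P measurableT) _; rewrite ltry.
exists M; split; first by rewrite num_real.
by move=> K MK x _ /=; exact: le_trans (ltW MK).
Qed.

End probability_integrable.

(** * Integration against the semicircle law and its Chebyshev moments *)

Section semicircle_integral.
Context {R : realType}.
Local Notation leb := (@lebesgue_measure R).
Local Notation sigma := (@semicircle_prob R).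

Lemma semicircle_dominates : sigma `<< leb.
Proof.
apply/null_content_dominatesP => A mA A0.
apply: null_set_integral => //.
by apply/measurable_EFinP/measurable_funTS; exact: measurable_semicircle_pdf.
Qed.

(** The density integrates to [sigma] over every measurable set, so it agrees almost everywhere with
    the Radon-Nikodym derivative, for which the change of variables is available. *)
Lemma integral_semicircle (f : R -> \bar R) : sigma.-integrable setT f ->
  (\int[sigma]_x f x = \int[leb]_x (f x * (semicircle_pdf x)%:E))%E.
Proof.
move=> fi.
have mf := measurable_int _ fi.
rewrite -(Radon_Nikodym_change_of_variables semicircle_dominates)//=.
have mpdf : measurable_fun setT (fun x : R => (semicircle_pdf x)%:E).
  by apply/measurable_EFinP; exact: measurable_semicircle_pdf.
apply: ae_eq_integral => //.
- apply: emeasurable_funM => //; apply: (measurable_int leb).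
  by apply: Radon_Nikodym_integrable; exact: semicircle_dominates.
- exact: emeasurable_funM.
- apply: ae_eqe_mul2l => /=.
  rewrite Radon_NikodymE//=; first exact: semicircle_dominates.
  move=> dom; case: cid => /= h [h1 h2 h3].
  by apply: integral_ae_eq => //= E _ mE; rewrite -h3.
Qed.

(** Chebyshev polynomials are unbounded on the line; precomposing with this retraction onto [-2, 2]
    makes them bounded and continuous without changing them on the support of the semicircle law. *)
Definition clamp2 (x : R) := Num.max (-2) (Num.min x 2).

Lemma clamp2_le x : `|clamp2 x| <= 2.
Proof. by rewrite ler_norml /clamp2 le_max lexx/= ge_max ge_min lexx orbT andbT; lra. Qed.

Lemma clamp2_id x : `|x| <= 2 -> clamp2 x = x.
Proof.
by rewrite ler_norml => /andP[xl xu]; rewrite /clamp2 min_l// max_r.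
Qed.

Lemma continuous_clamp2 : continuous clamp2.
Proof.
move=> x.
have cm : {for x, continuous ((id : R -> R) \min cst 2)}.
  by apply: continuous_min; [exact: cvg_id|exact: cvg_cst].
exact: (@continuous_max _ _ (cst (-2)) _ x (cvg_cst _) cm).
Qed.

Lemma continuous_chebyshev_rec (a : R) (b : R -> R) n : continuous b ->
  continuous (fun x => chebyshev_rec a (b x) x n).
Proof.
move=> cb; elim/nat_ind2: n => [x|//|n IH0 IH1 x]; first exact: cvg_cst.
apply: (@cvgB _ R^o); last exact: IH0.
by apply: cvgM; [exact: cvg_id|exact: IH1].
Qed.

Lemma continuous_chebT n : continuous (fun x : R => chebT x n).
Proof.
by apply: continuous_chebyshev_rec => x; apply: cvgM; [exact: cvg_id|exact: cvg_cst].
Qed.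

Lemma continuous_chebU n : continuous (fun x : R => chebU x n).
Proof. by apply: (@continuous_chebyshev_rec 0 (cst 1)) => x; exact: cvg_cst. Qed.

Lemma sin_natpi n : sin (n%:R * pi) = 0 :> R.
Proof.
elim: n => [|n IH]; first by rewrite mul0r sin0.
by rewrite -natr1 mulrDl mul1r sinDpi IH oppr0.
Qed.

Lemma semicircle_pdf_out x : 2 <= `|x| -> semicircle_pdf x = 0 :> R.
Proof.
move=> x2; rewrite /semicircle_pdf max_r ?sqrtr0 ?mul0r// subr_le0.
rewrite -(real_normK (num_real x)) (_ : 4 = 2 ^+ 2); last by ring.
by rewrite lerXn2r ?nnegrE.
Qed.

Lemma semicircle_pdf_cos (t : R) : 0 <= t <= pi ->
  semicircle_pdf (2 * cos t) = sin t / pi.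
Proof.
move=> /sin_ge0_pi st; rewrite /semicircle_pdf.
have -> : Num.max (4 - (2 * cos t) ^+ 2) 0 = (2 * sin t) ^+ 2.
  have e : 4 - (2 * cos t) ^+ 2 = (2 * sin t) ^+ 2.
    by rewrite !exprMn sin2cos2; ring.
  by rewrite e max_l// sqr_ge0.
rewrite sqrtr_sqr ger0_norm ?mulr_ge0//.
by have := gt_eqF (pi_gt0 R); move: (pi : R) (sin t) => p s p0; field; rewrite p0.
Qed.

Lemma derivable_oo_LR (F f : R -> R) a b :
  (forall t : R, is_derive t 1 F (f t)) -> derivable_oo_LRcontinuous F a b.
Proof.
move=> dF.
have cF : continuous F.
  by move=> t; apply/differentiable_continuous/derivable1_diffP; case: (dF t).
split.
- by move=> t _; case: (dF t).
- exact/cvg_at_right_filter/cF.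
- exact/cvg_at_left_filter/cF.
Qed.

Lemma integral_semicircle_cos (f : R -> R) : continuous f ->
  sigma.-integrable setT (EFin \o f) ->
  (\int[sigma]_x (f x)%:E =
   \int[leb]_(t in `[0%R, pi]) (f (2 * cos t) * (2 / pi * sin t ^+ 2))%:E)%E.
Proof.
move=> cf fi; have pi0 := pi_gt0 R.
rewrite integral_semicircle//.
pose F (t : R) : R := 2 * cos t.
have dF (t : R) : is_derive t 1 F (- (2 * sin t)).
  rewrite /F; apply: is_derive_eq.
  by rewrite /GRing.scale/=; ring.
have F'E : derive1 F = (fun t => - (2 * sin t)).
  by apply/funext => t; rewrite derive1E; have [_ ->] := dF t.
have cF' : continuous (fun t : R => - (2 * sin t)).
  by move=> t; apply: cvgN; apply: cvgM; [exact: cvg_cst|exact: continuous_sin].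
transitivity (\int[leb]_(x in `[F pi, F 0%R]) (f x * semicircle_pdf x)%:E)%E.
  rewrite /F cospi cos0 mulrN1 mulr1 [RHS]integral_mkcond; apply: eq_integral => x _.
  rewrite patchE; case: ifPn => // /negP; rewrite inE/= in_itv/= => /negP.
  rewrite negb_and -!ltNge => x2; rewrite semicircle_pdf_out ?mule0//.
  by rewrite ler_normr; case/orP: x2 => /ltW x2; apply/orP; [right; lra|left].
rewrite (integration_by_substitution_decreasing (F := F)); first last.
- apply: continuous_subspaceT => x.
  by apply: cvgM; [exact: cf|exact: continuous_semicircle_pdf].
- exact: derivable_oo_LR dF.
- by rewrite F'E; apply/cvg_ex; eexists; exact/cvg_at_left_filter/cF'.
- by rewrite F'E; apply/cvg_ex; eexists; exact/cvg_at_right_filter/cF'.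
- by move=> x _; rewrite F'E; exact: cF'.
- by move=> x y xpi ypi xy; rewrite /F ltr_pM2l// ltr_cos.
- exact: ltW.
apply: eq_integral => t; rewrite inE/= in_itv/= => tpi; congr (_%:E).
rewrite F'E /=; transitivity (f (F t) * semicircle_pdf (F t) * (2 * sin t)).
  by congr (_ * _); rewrite /= opprK.
by rewrite semicircle_pdf_cos// /F; ring.
Qed.

(** Under [x = 2 cos t], [chebU x n * sin t = sin (n t)], so for [n >= 2] the integrand is
    [(cos ((n - 1) t) - cos ((n + 1) t)) / pi], whose primitive vanishes at 0 and [pi]. These
    moments are what the later sections assume of a semicircular variable. *)
Lemma integral_semicircle_chebU n :
  (\int[sigma]_x (chebU (clamp2 x) n)%:E = (n == 1)%:R%:E)%E.
Proof.
case: n => [|[|n]].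
- by under eq_integral do rewrite /chebU/=; rewrite integral0.
- under eq_integral do rewrite /chebU/=.
  by rewrite integral_cst//= mul1e; exact: probability_setT.
have cf : continuous (fun x => chebU (clamp2 x) n.+2).
  move=> x; apply: (@continuous_comp _ _ _ clamp2 (fun x => chebU x n.+2)).
    exact: continuous_clamp2.
  exact: continuous_chebU.
rewrite integral_semicircle_cos//; last first.
  apply: (@integrable_le _ _ _ _ _ n.+2%:R).
    exact: continuous_measurable_fun.
  by move=> x; apply: chebU_len; exact: clamp2_le.
have pi0 := pi_gt0 R.
pose g (t : R) := pi^-1 * (cos (n.+1%:R * t) - cos (n.+3%:R * t)).
pose G (t : R) := pi^-1 * (sin (n.+1%:R * t) / n.+1%:R - sin (n.+3%:R * t) / n.+3%:R).
have dsin (k : nat) (t : R) : is_derive t 1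
    (fun t : R => sin (k.+1%:R * t) / k.+1%:R) (cos (k.+1%:R * t)).
  have d1 : is_derive t 1 (fun t : R => k.+1%:R * t) k.+1%:R.
    have := @is_deriveZ R R^o R^o (fun s : R => s) k.+1%:R t 1 1 (is_derive_id _ _).
    by congr is_derive; rewrite /GRing.scale/= mulr1.
  have d2 := @is_derive1_comp R sin (fun t : R => k.+1%:R * t) t _ _
    (is_derive_sin _) d1.
  have := @is_deriveZ R R^o R^o _ k.+1%:R^-1 t 1 _ d2.
  congr is_derive; first by apply/funext => z; rewrite /= /GRing.scale/= mulrC.
  by rewrite /GRing.scale/= mulrC mulfK// pnatr_eq0.
have dG (t : R) : is_derive t 1 G (g t).
  by apply: (@is_deriveZ R R^o R^o _ pi^-1 t 1); apply: is_deriveB; exact: dsin.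
have ccos (k : nat) : continuous (fun t : R => cos (k%:R * t)).
  move=> t; apply: (@continuous_comp _ _ _ (fun t : R => k%:R * t) cos).
    by apply: cvgM; [exact: cvg_cst|exact: cvg_id].
  exact: continuous_cos.
have cg : continuous g.
  move=> t; apply: cvgM; first exact: cvg_cst.
  by apply: (@cvgB _ R^o); exact: ccos.
transitivity (\int[leb]_(t in `[0%R, pi]) (g t)%:E)%E.
  apply: eq_integral => t _; congr (_%:E).
  rewrite clamp2_id; last first.
    by rewrite normrM ger0_norm// ler_piMr// ler_norml cos_geN1 cos_le1.
  have -> : chebU (2 * cos t) n.+2 * (2 / pi * sin t ^+ 2) =
    2 / pi * (chebU (2 * cos t) n.+2 * sin t) * sin t by ring.
  rewrite chebU_sin /g.
  have -> : n.+1%:R * t = n.+2%:R * t - t by rewrite -[n.+2%:R]natr1; ring.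
  have -> : n.+3%:R * t = n.+2%:R * t + t by rewrite -[n.+3%:R]natr1; ring.
  by rewrite !cosD cosN sinN; ring.
rewrite (continuous_FTC2 (F := G)).
- rewrite /G !sin_natpi !mulr0 !sin0 !mul0r !subrr !mulr0.
  by rewrite -EFinB subrr.
- exact: pi0.
- by apply: continuous_subspaceT => x; exact: cg.
- exact: derivable_oo_LR dG.
- by move=> x _; rewrite derive1E; have [_ ->] := dG x.
Qed.

Lemma integrable_chebU d (T : measurableType d) (P : probability T R) (X : T -> R) n :
  measurable_fun setT X -> (forall u, `|X u| <= 2) ->
  P.-integrable setT (fun u => (chebU (X u) n)%:E).
Proof.
move=> mX X2; apply: (@integrable_le _ _ _ _ _ n%:R) => [|u]; last exact: chebU_len.
have mc := continuous_measurable_fun (@continuous_chebU n).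
exact: (measurableT_comp mc mX).
Qed.

Lemma integrable_chebT d (T : measurableType d) (P : probability T R) (X : T -> R) n :
  measurable_fun setT X -> (forall u, `|X u| <= 2) ->
  P.-integrable setT (fun u => (chebT (X u) n)%:E).
Proof.
move=> mX X2; apply: (@integrable_le _ _ _ _ _ 1) => [|u]; last exact: chebT_le1.
have mc := continuous_measurable_fun (@continuous_chebT n).
exact: (measurableT_comp mc mX).
Qed.

End semicircle_integral.

(** * Limits and measurability for the regularised kernel *)

Section sequences.
Context {R : realType}.

(** Half of the decay absorbs the linear factor: with [s = sqrt r], [n * s ^ n] is at most the
    geometric sum and hence [1 / (1 - s)], and a factor [s ^ n] remains. *)
Lemma cvg_natr_mul_expr (r : R) : 0 <= r < 1 ->
  n.+3%:R * r ^+ n @[n --> \oo] --> (0 : R).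
Proof.
move=> /andP[r0 r1]; pose s := Num.sqrt r.
have s0 : 0 <= s by exact: sqrtr_ge0.
have s1 : s < 1 by rewrite -sqrtr1 ltr_sqrt.
have ns n : n%:R * s ^+ n <= (1 - s)^-1.
  have : n%:R * s ^+ n <= \sum_(k < n) s ^+ k.
    rewrite mulr_natl -[leLHS](_ : \sum_(k < n) s ^+ n = _); last first.
      by rewrite sumr_const card_ord.
    apply: ler_sum => k _; by apply: ler_wiXn2l => //; [exact: ltW|exact/ltnW/ltn_ord].
  move/le_trans; apply.
  have s1' : 0 < 1 - s by rewrite subr_gt0.
  rewrite -(ler_pM2l s1') divff ?gt_eqF//.
  by rewrite -[leLHS]opprK -mulNr opprB -subrX1 opprB lerBlDr lerDl exprn_ge0.
have rE n : r ^+ n = s ^+ n * s ^+ n by rewrite -exprMn -expr2 sqr_sqrtr.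
apply: (@squeeze_cvgr _ _ _ _ (cst 0) (fun n => ((1 - s)^-1 + 3) * s ^+ n)).
- apply: nearW => n; rewrite mulr_ge0 ?exprn_ge0//=.
  rewrite rE mulrA ler_wpM2r ?exprn_ge0// -[n.+3]addn3 natrD mulrDl.
  by rewrite lerD// ler_piMr// exprn_ile1// ltW.
- exact: cvg_cst.
- rewrite -[X in _ --> X](mulr0 ((1 - s)^-1 + 3)).
  by apply: cvgM; [exact: cvg_cst|apply: cvg_expr; rewrite ger0_norm].
Qed.

Lemma eq0_le_cvg0 (a : R) (u : nat -> R) : u n @[n --> \oo] --> (0 : R) ->
  (forall n, `|a| <= u n) -> a = 0.
Proof.
move=> u0 au; apply/eqP; rewrite -normr_le0.
rewrite -(cvg_lim (@Rhausdorff R) u0); apply: limr_ge.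
  by apply/cvg_ex; exists 0.
exact: nearW.
Qed.

Lemma measurable_invr : measurable_fun setT (@GRing.inv R).
Proof.
(* Squaring makes the argument of the measurable function [powR] nonnegative; at 0 both sides are 0
   by the convention on inverses. *)
rewrite (_ : GRing.inv = fun x : R => x * (x ^+ 2) `^ (-1)); last first.
  apply/funext => x; rewrite powR_inv1 ?sqr_ge0//.
  have [->|x0] := eqVneq x 0; first by rewrite invr0 mul0r.
  by field.
apply: measurable_funM => //.
by apply: (@measurableT_comp _ _ _ _ _ _ (@powR R ^~ (-1)) setT (fun x : R => x ^+ 2)) => //.
Qed.

Lemma measurable_cheb_ker d (S : measurableType d) r (f g : S -> R) :
  measurable_fun setT f -> measurable_fun setT g ->
  measurable_fun setT (fun v => cheb_ker r (f v) (g v)).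
Proof.
move=> mf mg; have mc (c : R) : measurable_fun setT (fun _ : S => c) by [].
have mfg := measurable_funM mf mg.
have mxy k := measurable_funM mfg (mc (r ^+ k)).
have me := measurable_funM (measurable_funB (measurable_funD
  (measurable_funX 2 mf) (measurable_funX 2 mg)) (mc 2)) (mc (r ^+ 2)).
have mden : measurable_fun setT (fun v => cheb_den (f v) (g v) r).
  exact: (measurable_funD (measurable_funB (measurable_funD
    (measurable_funB (mc 1) (mxy 1%N)) me) (mxy 3%N)) (mc (r ^+ 4))).
apply: measurable_funM.
  exact: (measurable_funM (mc (r * (1 + r) ^+ 2)) (measurable_funB mf mg)).
exact: (measurableT_comp measurable_invr (measurable_funM (mc 4) mden)).
Qed.

End sequences.

(** * Moments of a variable with the Chebyshev moments of the semicircle law *)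

Section semicircular_variable.
Context d (T : measurableType d) (R : realType) (P : probability T R).
Variable X : T -> R.
Hypothesis mX : measurable_fun setT X.
Hypothesis X2 : forall u, `|X u| <= 2.
Hypothesis XU : forall n, (\int[P]_u (chebU (X u) n)%:E = (n == 1)%:R%:E)%E.

Lemma integral_chebT0 : (\int[P]_u (chebT (X u) 0)%:E = 1)%E.
Proof.
under eq_integral do rewrite /chebT/=.
by rewrite integral_cst//= mul1e; exact: probability_setT.
Qed.

(** In positive degree only degree 2 has a nonzero mean, -1/2; this is the source of the constant
    -1/4 in the logarithmic energy. *)
Lemma integral_chebT n :
  (\int[P]_u (chebT (X u) n.+1)%:E = (- (n == 1)%:R / 2)%:E)%E.
Proof.
under eq_integral do rewrite chebT_chebU mulrC EFinM EFinB.
rewrite integralZl//; last first.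
  exact: (integrableB measurableT (integrable_chebU _ _ mX X2)
    (integrable_chebU _ _ mX X2)).
rewrite integralB_EFin//; [|exact: integrable_chebU|exact: integrable_chebU].
by rewrite !XU -EFinB -EFinM eqSS/= sub0r mulrC.
Qed.

Lemma integral_sqr_semicircular : (\int[P]_u (X u ^+ 2)%:E = 1)%E.
Proof.
transitivity (\int[P]_u ((chebU (X u) 3)%:E + (chebU (X u) 1)%:E))%E.
  by apply: eq_integral => u _; rewrite -EFinD /chebU/=; congr (_%:E); ring.
by rewrite integralD_EFin//; [rewrite !XU add0e|exact: integrable_chebU..].
Qed.

(** A regularised form of the Hilbert transform [x / 2] of the semicircle law. In the termwise
    integral of the expansion, the [chebU] moment of degree 1 contributes [r * x / 4] and the
    [chebT] moment of degree 2 contributes [r ^ 2 * x / 4]. *)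
Lemma integral_cheb_ker (r x : R) : `|x| <= 2 -> 0 <= r < 1 ->
  (\int[P]_v (cheb_ker r x (X v))%:E = (r * (1 + r) / 4 * x)%:E)%E.
Proof.
move=> x2 r01; have /andP[r0 r1] := r01.
have ik : P.-integrable setT (EFin \o (fun v => cheb_ker r x (X v))).
  apply: integrable_le (measurable_cheb_ker r _ mX) _ => // u.
  exact: cheb_ker_le.
pose a (n : nat) v := r ^+ n * ((chebT x n * chebU (X v) n - chebU x n * chebT (X v) n) / 2).
have aE n v : a n v = (r ^+ n * chebT x n / 2) * chebU (X v) n -
    (r ^+ n * chebU x n / 2) * chebT (X v) n.
  by rewrite /a; field.
have iU n c : P.-integrable setT (EFin \o (fun v => c * chebU (X v) n)).
  exact: (integrableZl measurableT c (integrable_chebU P n mX X2)).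
have iT n c : P.-integrable setT (EFin \o (fun v => c * chebT (X v) n)).
  exact: (integrableZl measurableT c (integrable_chebT P n mX X2)).
have ia n : P.-integrable setT (EFin \o a n).
  rewrite (_ : a n = fun v => (r ^+ n * chebT x n / 2) * chebU (X v) n -
    (r ^+ n * chebU x n / 2) * chebT (X v) n); last by apply/funext => v; exact: aE.
  exact: (integrableB measurableT (iU _ _) (iT _ _)).
have int_a n : (\int[P]_v (a n v)%:E = ((r * x / 4) *+ (n == 1) + (r ^+ 2 * x / 4) *+ (n == 2))%:E)%E.
  under eq_integral do rewrite aE.
  rewrite integralB_EFin//.
  under eq_integral do rewrite EFinM.
  under [X in (_ - X)%E]eq_integral do rewrite EFinM.
  rewrite !integralZl//; [|exact: integrable_chebT|exact: integrable_chebU].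
  rewrite XU; case: n => [|n].
    by rewrite integral_chebT0 -!EFinM -EFinB /chebU/=; congr (_%:E); ring.
  rewrite integral_chebT -!EFinM -EFinB eqSS; congr (_%:E).
  by case: n => [|[|n]] /=; rewrite /chebT /chebU /=; field.
have isum N : P.-integrable setT (EFin \o (fun v => \sum_(n < N) a n v)).
  rewrite (_ : EFin \o _ = fun v => (\sum_(n < N) (a n v)%:E)%E); last first.
    by apply/funext => v; rewrite /= sumEFin.
  exact: (@integrable_sum _ _ _ _ _ measurableT _ _ _ (fun n : 'I_N => EFin \o a n)).
(* With at least three terms, degrees 1 and 2 are always included, so the integral of the truncated
   sum does not depend on [N], while the truncation error tends to 0. *)
have int_sum N : (\int[P]_v (\sum_(n < N.+3) a n v)%:E = (r * (1 + r) / 4 * x)%:E)%E.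
  under eq_integral do rewrite -sumEFin.
  rewrite integral_sum//; last by move=> n; exact: ia.
  under eq_bigr => k _ do rewrite int_a.
  rewrite sumEFin !big_ord_recl/= big1 => [|n _]; last by rewrite !mulr0n addr0.
  by congr (_%:E); rewrite !mulr0n !mulr1n; field.
suff : fine (\int[P]_v (cheb_ker r x (X v))%:E)%E - r * (1 + r) / 4 * x = 0.
  move=> /subr0_eq <-; rewrite fineK//; exact: integrable_fin_num ik.
pose C := 32 / (1 - r) ^+ 4.
apply: (@eq0_le_cvg0 _ _ (fun N => C * (N.+3.+3%:R * r ^+ N.+3))).
  rewrite -[X in _ --> X](mulr0 C); apply: cvgM; first exact: cvg_cst.
  have := cvg_natr_mul_expr r01; rewrite -(cvg_shiftn 3).
  by under [X in X @ _ --> _ -> _]eq_fun do rewrite addn3.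
move=> N.
rewrite -[r * (1 + r) / 4 * x]/(fine (r * (1 + r) / 4 * x)%:E) -(int_sum N).
rewrite -fineB ?(integrable_fin_num measurableT ik) ?(integrable_fin_num measurableT (isum _))//.
rewrite -integralB_EFin//.
have ikB := integrableB measurableT ik (isum N.+3).
rewrite -fine_abse ?(integrable_fin_num measurableT ikB)//.
have CM0 : 0 <= C * (N.+3.+3%:R * r ^+ N.+3).
  apply: mulr_ge0; last by rewrite mulr_ge0// exprn_ge0.
  by rewrite divr_ge0// exprn_ge0// subr_ge0 ltW.
rewrite -[leRHS]/(fine (C * (N.+3.+3%:R * r ^+ N.+3))%:E).
apply: fine_le; rewrite ?abse_fin_num ?(integrable_fin_num measurableT ikB)//.
rewrite -[leRHS]mule1 -(@probability_setT _ _ _ P).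
apply: le_trans (le_abse_integral _ _ _) _ => //.
  exact: measurable_int ikB.
apply: (@integral_le_bound _ _ _ P setT (fun v => (cheb_ker r x (X v))%:E - (\sum_(n < N.+3) a n v)%:E)%E) => //.
  exact: measurable_int ikB.
apply: aeW => v _; rewrite -EFinB abse_EFin lee_fin.
apply: le_trans (cheb_ker_sum _ x2 (X2 v) r01) _.
by rewrite /C mulrAC mulrC mulrA mulrAC.
Qed.

End semicircular_variable.

(** * Integrals over the product of two copies of a probability space *)

Section product.
Context d (T : measurableType d) (R : realType) (P : probability T R).

Lemma integrable_fst (f : T -> R) : P.-integrable setT (EFin \o f) ->
  (P \x P)%E.-integrable setT (fun z : T * T => (f z.1)%:E).
Proof.
move=> fi; have mf : measurable_fun setT (EFin \o f) := measurable_int _ fi.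
apply/integrable12ltyP; first exact: (measurableT_comp mf measurable_fst).
under eq_integral.
  move=> u _; rewrite /= integral_cst// [X in (_ * X)%E](@probability_setT _ _ _ P) mule1.
  over.
by case/integrableP: fi.
Qed.

Lemma integrable_snd (f : T -> R) : P.-integrable setT (EFin \o f) ->
  (P \x P)%E.-integrable setT (fun z : T * T => (f z.2)%:E).
Proof.
move=> fi; have mf : measurable_fun setT (EFin \o f) := measurable_int _ fi.
apply/integrable21ltyP; first exact: (measurableT_comp mf measurable_snd).
under eq_integral.
  move=> u _; rewrite /= integral_cst// [X in (_ * X)%E](@probability_setT _ _ _ P) mule1.
  over.
by case/integrableP: fi.
Qed.

(** Tonelli's theorem applied to the positive and negative parts, so that it covers the logarithm,
    whose integral may be infinite. *)
Lemma measurable_fun_fubini_G (f : T * T -> \bar R) : measurable_fun setT f ->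
  measurable_fun setT (fun v => \int[P]_u f (u, v))%E.
Proof.
move=> mf.
have -> : (fun v => \int[P]_u f (u, v))%E = (fun v =>
    \int[P]_u (f^\+)%E (u, v) - \int[P]_u (f^\-)%E (u, v))%E.
  by apply/funext => v; rewrite integralE; congr (_ - _)%E;
    apply: eq_integral => u _; rewrite ?funeposE ?funenegE.
apply: emeasurable_funB.
  apply: (measurable_fun_fubini_tonelli_G (m1 := P) (f^\+)%E);
    [exact: measurable_funepos|by move=> z; exact: funepos_ge0].
apply: (measurable_fun_fubini_tonelli_G (m1 := P) (f^\-)%E);
  [exact: measurable_funeneg|by move=> z; exact: funeneg_ge0].
Qed.

(* Unlike [le_integral], this does not require integrability; the convention
   [+oo - +oo = -oo] is harmless because it applies to both sides. *)
Lemma le_integral_measurable (f g : T -> \bar R) :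
  measurable_fun setT f -> measurable_fun setT g ->
  (forall u, f u <= g u)%E -> (\int[P]_u f u <= \int[P]_u g u)%E.
Proof.
move=> mf mg fg; rewrite integralE [leRHS]integralE; apply: leeB.
  apply: ge0_le_integral => //; try exact: measurable_funepos.
  by move=> u _; rewrite !funeposE ge_max !le_max fg lexx orbT.
apply: ge0_le_integral => //; try exact: measurable_funeneg.
by move=> u _; rewrite !funenegE ge_max !le_max leeN2 fg lexx orbT.
Qed.

End product.

(** * Mean difference quotient of a monotone pair *)

Section comonotone.
Context d (T : measurableType d) (R : realType) (P : probability T R).
Variables X Y : T -> R.
Hypothesis mX : measurable_fun setT X.
Hypothesis mY : measurable_fun setT Y.
Hypothesis X2 : forall u, `|X u| <= 2.
Hypothesis XU : forall n, (\int[P]_u (chebU (X u) n)%:E = (n == 1)%:R%:E)%E.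
Hypothesis iY : P.-integrable setT (EFin \o Y).
Hypothesis mono : forall u v, 0 <= (Y u - Y v) * (X u - X v).
Hypothesis inj : forall u v, X u = X v -> Y u = Y v.

Let rho := fine (\int[P]_u (X u * Y u)%:E)%E.

Lemma integrable_mulXY : P.-integrable setT (EFin \o (fun u => X u * Y u)).
Proof.
apply: (le_integrable measurableT _ _ (integrableZl measurableT 2 iY)).
  by apply/measurable_EFinP; exact: measurable_funM.
by move=> u _; rewrite /= lee_fin !normrM ler_wpM2r// (ger0_norm (ler0n _ 2)).
Qed.

Let integral_XY : (\int[P]_u (X u * Y u)%:E = rho%:E)%E.
Proof. by rewrite /rho fineK//; exact: integrable_fin_num integrable_mulXY. Qed.

Let mXfst : measurable_fun setT (fun z : T * T => X z.1).
Proof. exact: measurableT_comp mX measurable_fst. Qed.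
Let mXsnd : measurable_fun setT (fun z : T * T => X z.2).
Proof. exact: measurableT_comp mX measurable_snd. Qed.
Let mYfst : measurable_fun setT (fun z : T * T => Y z.1).
Proof. exact: measurableT_comp mY measurable_fst. Qed.
Let mYsnd : measurable_fun setT (fun z : T * T => Y z.2).
Proof. exact: measurableT_comp mY measurable_snd. Qed.

Let ker r (z : T * T) := cheb_ker r (X z.1) (X z.2).

Let integrable_ker_mul r (f : T * T -> R) : 0 <= r < 1 ->
  (P \x P)%E.-integrable setT (EFin \o f) ->
  (P \x P)%E.-integrable setT (EFin \o (fun z => f z * ker r z)).
Proof.
move=> r01 fi; have := fun z : T * T => cheb_ker_le (X2 z.1) (X2 z.2) r01.
move: (4 / _) => C kC.
have mf : measurable_fun setT f by apply/measurable_EFinP; exact: measurable_int fi.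
apply: (le_integrable measurableT _ _ (integrableZl measurableT C fi)).
  by apply/measurable_EFinP; apply: measurable_funM => //; exact: measurable_cheb_ker.
move=> z _; rewrite /= lee_fin (normrM (f z)) (normrM C) mulrC ler_wpM2r//.
exact: le_trans (kC z) (ler_norm _).
Qed.

(** The kernel is antisymmetric, so the two terms of the difference contribute equally; each reduces
    by [integral_cheb_ker] to [r * (1 + r) / 4] times the mean of [X * Y]. *)
Lemma integral_diff_ker r : 0 <= r < 1 ->
  (\int[P \x P]_z ((Y z.1 - Y z.2) * ker r z)%:E = (r * (1 + r) / 2 * rho)%:E)%E.
Proof.
move=> r01.
have i1 := integrable_ker_mul r01 (integrable_fst iY).
have i2 := integrable_ker_mul r01 (integrable_snd iY).
have iXYr (c : R) : (\int[P]_u (Y u * (c * X u))%:E = (c * rho)%:E)%E.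
  under eq_integral => u _ do rewrite mulrCA (mulrC (Y u)) EFinM.
  by rewrite integralZl//; [rewrite integral_XY|exact: integrable_mulXY].
have iker x : `|x| <= 2 -> P.-integrable setT (EFin \o (fun v => cheb_ker r x (X v))).
  move=> x2; apply: (integrable_le _ (measurable_cheb_ker r _ mX)) => // u.
  exact: cheb_ker_le.
under eq_integral do rewrite mulrBl.
rewrite integralB_EFin//.
rewrite -(integral12_prod_meas1 i1) -(integral21_prod_meas1 i2).
rewrite /fubini_F /fubini_G /ker /=.
under eq_integral => u _.
  under eq_integral do rewrite EFinM.
  rewrite integralZl//; last exact: iker.
  rewrite (integral_cheb_ker mX X2 XU (X2 u) r01) -EFinM.
  over.
rewrite iXYr.
under [X in (_ - X)%E]eq_integral => v _.
  under eq_integral => u _ do rewrite cheb_kerC mulrN -mulNr EFinM.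
  rewrite integralZl//; last exact: iker.
  rewrite (integral_cheb_ker mX X2 XU (X2 v) r01) -EFinM mulNr -mulrN -mulNr.
  over.
by rewrite iXYr -EFinB; congr (_%:E); field.
Qed.

(** Where [X z.1 = X z.2] the quotient is 0, which by [inj] is also the value of
    [(Y z.1 - Y z.2) * ker r z] for every [r]. *)
Let quot (z : T * T) := (Y z.1 - Y z.2) / (X z.1 - X z.2).

Lemma quot_ge0 z : 0 <= quot z.
Proof.
rewrite /quot; have [->|xy] := eqVneq (X z.1 - X z.2) 0; first by rewrite invr0 mulr0.
have -> : (Y z.1 - Y z.2) / (X z.1 - X z.2) =
  ((Y z.1 - Y z.2) * (X z.1 - X z.2)) / (X z.1 - X z.2) ^+ 2 by field.
by rewrite divr_ge0// sqr_ge0.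
Qed.

Lemma measurable_quot : measurable_fun setT quot.
Proof.
apply: measurable_funM; first exact: measurable_funB.
exact: (measurableT_comp measurable_invr (measurable_funB mXfst mXsnd)).
Qed.

Lemma cvg_cheb_ker (r : nat -> R) (x y : R) : r n @[n --> \oo] --> (1 : R) ->
  x != y -> cheb_ker (r n) x y @[n --> \oo] --> (x - y)^-1.
Proof.
move=> r1 xy.
have rX k : r n ^+ k @[n --> \oo] --> (1 : R).
  rewrite -[X in _ --> X](expr1n R k).
  exact: (continuous_cvg _ (@exprn_continuous R k 1) r1).
have cden : cheb_den x y (r n) @[n --> \oo] --> (x - y) ^+ 2.
  have -> : (x - y) ^+ 2 = 1 - x * y * 1 + (x ^+ 2 + y ^+ 2 - 2) * 1 - x * y * 1 + 1.
    by ring.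
  apply: (@cvgD _ R^o); last exact: rX.
  apply: (@cvgB _ R^o); last by apply: cvgM; [exact: cvg_cst|exact: rX].
  apply: (@cvgD _ R^o); last by apply: cvgM; [exact: cvg_cst|exact: rX].
  by apply: (@cvgB _ R^o); [exact: cvg_cst|apply: cvgM; [exact: cvg_cst|exact: r1]].
have xy0 : x - y != 0 by rewrite subr_eq0.
have -> : (x - y)^-1 = 1 * (1 + 1) ^+ 2 * (x - y) / (4 * (x - y) ^+ 2) by field.
apply: cvgM.
  apply: cvgM; last exact: cvg_cst.
  apply: cvgM; first exact: r1.
  have c2 : (1 + r n : R) @[n --> \oo] --> (1 + 1 : R).
    by apply: (@cvgD _ R^o); [exact: cvg_cst|exact: r1].
  exact: (continuous_cvg _ (@exprn_continuous R 2 (1 + 1)) c2).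
apply: cvgV; first by rewrite mulf_neq0// expf_neq0.
by apply: cvgM; [exact: cvg_cst|exact: cden].
Qed.

(** Fatou's lemma along [r n = 1 - 1 / (n + 1)]: the regularised integrands are nonnegative by
    [mono] and converge pointwise to [quot], and their integrals tend to [rho]. *)
Lemma integral_quot_le : (\int[P \x P]_z (quot z)%:E <= rho%:E)%E.
Proof.
pose r (n : nat) : R := 1 - n.+1%:R^-1.
have r01 n : 0 <= r n < 1.
  by rewrite /r subr_ge0 invf_le1// ler1n/= ltrBlDr ltrDl invr_gt0.
have r1 : r n @[n --> \oo] --> (1 : R).
  rewrite -[X in _ --> X]subr0; apply: (@cvgB _ R^o); first exact: cvg_cst.
  exact: cvg_harmonic.
pose h n z := ((Y z.1 - Y z.2) * ker (r n) z)%:E.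
have hq z : h n z @[n --> \oo] --> (quot z)%:E.
  apply: cvg_EFin; first exact: nearW.
  have [xy|xy] := eqVneq (X z.1) (X z.2).
    rewrite /quot (inj xy) subrr mul0r.
    under [X in X @ _ --> _]eq_fun do rewrite /h /= (inj xy) subrr mul0r.
    exact: cvg_cst.
  apply: cvgM; first exact: cvg_cst.
  exact: cvg_cheb_ker.
have <- : limn_einf (fun n => \int[P \x P]_z h n z)%E = rho%:E.
  apply: (cvg_limn_einf_sup _).1.
  under [X in X @ _ --> _]eq_fun do rewrite integral_diff_ker//.
  apply: cvg_EFin; first exact: nearW.
  rewrite -[X in _ --> X]mul1r; apply: cvgM; last exact: cvg_cst.
  rewrite [X in _ --> X](_ : 1 = 1 * (1 + 1) / 2); last by field.
  apply: cvgM; last exact: cvg_cst.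
  apply: cvgM; first exact: r1.
  by apply: (@cvgD _ R^o); [exact: cvg_cst|exact: r1].
under eq_integral => z _ do rewrite -((cvg_limn_einf_sup (hq z)).1).
apply: fatou => // n.
  apply/measurable_EFinP; apply: measurable_funM; first exact: measurable_funB.
  exact: measurable_cheb_ker.
move=> z _; rewrite lee_fin; apply: cheb_ker_mul_ge0 => //; exact: mono.
Qed.

End comonotone.

(** * The uniform variable on [0, 1] *)

Section uniform01.
Context {R : realType}.

Lemma probability_eq_on d (T : measurableType d) (P : probability T R) (D A B : set T) :
  measurable D -> measurable A -> measurable B -> P D = 1%E ->
  A `&` D = B `&` D -> P A = P B.
Proof.
move=> mD mA mB PD AB.
have E C : measurable C -> P C = P (C `&` D).
  move=> mC; rewrite (measureDI P mC mD).
  rewrite -[RHS]add0e; congr (_ + _)%E.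
  apply/eqP; rewrite eq_le measure_ge0 andbT.
  have <- : P (~` D) = 0%E by rewrite probability_setC// PD subee.
  by apply: le_measure; rewrite ?inE; [exact: measurableD|exact: measurableC|move=> x []].
by rewrite (E A)// (E B)// AB.
Qed.

Definition uniform01 : probability (measurableTypeR R) R := uniform_prob (@ltr01 R).

Lemma uniform01_itv (b0 b1 : bool) (a b : R) : 0 <= a -> b <= 1 -> a <= b ->
  uniform01 [set` Interval (BSide b0 a) (BSide b1 b)] = (b - a)%:E.
Proof.
move=> a0 b1' ab; rewrite /uniform01/= /uniform_prob.
rewrite (eq_integral (cst 1%E)); last first.
  move=> x; rewrite inE/= => xab; rewrite /uniform_pdf subr0 invr1 ifT//.
  move: xab; rewrite itv_boundlr => /andP[/= ax xb].
  have {}ax : a <= x by move: ax; case: b0 => //=; exact: ltW.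
  have {}xb : x <= b by move: xb; case: b1 => //=; exact: ltW.
  by rewrite (le_trans a0 ax) (le_trans xb b1').
rewrite integral_cst//= mul1e lebesgue_measure_itv/= lte_fin.
by case: ltgtP ab => // -> _; rewrite subrr.
Qed.

Lemma uniform01_itvNy (b : R) : 0 <= b <= 1 -> uniform01 `]-oo, b]%classic = b%:E.
Proof.
move=> /andP[b0 b1]; rewrite -[in RHS](subr0 b) -(uniform01_itv true false)//.
apply: (@probability_eq_on _ _ uniform01 `[0, 1]%classic) => //.
  by rewrite (uniform01_itv true false)// subr0.
apply/seteqP; split => x /=; rewrite !in_itv/=.
  by move=> [-> /andP[-> ->]].
by move=> [/andP[_ ->] ->].
Qed.

End uniform01.

(** * Quantile functions and the laws they realise *)

Section quantile.
Context {R : realType}.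
Variable mu : probability (measurableTypeR R) R.

Let F y := mu `]-oo, y]%classic.

Let idTR : measurableTypeR R -> R := idfun.
#[local] HB.instance Definition _ :=
  @isMeasurableFun.Build _ _ _ _ idTR (@measurable_id _ _ setT).

Let FE : F = cdf (idTR : {RV mu >-> R}).
Proof. by []. Qed.

Let F_homo x y : x <= y -> (F x <= F y)%E.
Proof. by rewrite FE; exact: cdf_nondecreasing. Qed.

Definition quantile (u : R) : R := inf [set y | (u%:E <= F y)%E].

(** The Galois connection between quantile and distribution functions. The limits 1 and 0 of the
    latter make the defining set nonempty and bounded below, and right continuity makes the infimum
    attained. *)
Lemma quantileP u y : 0 < u < 1 -> (quantile u <= y) = (u%:E <= mu `]-oo, y]%classic)%E.
Proof.
move=> /andP[u0 u1]; pose S := [set y | (u%:E <= F y)%E].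
have S0 : S !=set0.
  apply: contrapT => /set0P/negP/negPn/eqP S0.
  have : (1 <= u%:E)%E; last by rewrite lee_fin leNgt u1.
  have c1 := cvg_cdfy1 (idTR : {RV mu >-> R}).
  rewrite -(cvg_lim (@ereal_hausdorff R) c1); apply: lime_le.
    by apply/cvg_ex; exists 1%E.
  apply: nearW => z; rewrite leNgt; apply/negP => uz.
  have Sz : S z by rewrite /S/= FE ltW.
  by move: S0 => /seteqP[+ _] => /(_ _ Sz).
have lS : has_lbound S.
  apply: contrapT => lS.
  have : (u%:E <= 0)%E; last by rewrite lee_fin leNgt u0.
  have c0 := cvg_cdfNy0 (idTR : {RV mu >-> R}).
  rewrite -(cvg_lim (@ereal_hausdorff R) c0); apply: lime_ge.
    by apply/cvg_ex; exists 0%E.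
  apply: nearW => z; rewrite leNgt; apply/negP => zu.
  apply: lS; exists z => w; rewrite /S/= => uw; rewrite leNgt; apply/negP => wz.
  by have := lt_le_trans zu (le_trans uw (F_homo (ltW wz))); rewrite -FE ltxx.
apply/idP/idP => [Qy|uy]; last exact: ge_inf.
have FS z : y < z -> (u%:E <= F z)%E.
  move=> yz; have [s Ss sz] := inf_lt S0 (le_lt_trans Qy yz).
  exact: le_trans Ss (F_homo (ltW sz)).
have rc := @cdf_right_continuous _ _ _ _ (idTR : {RV mu >-> R}) y.
rewrite -/(F y) FE -(cvg_lim (@ereal_hausdorff R) rc); apply: lime_ge.
  by apply/cvg_ex; eexists; exact: rc.
by near=> z; rewrite -FE; apply: FS; near: z; exact: nbhs_right_gt.
Unshelve. all: by end_near. Qed.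

(* The retraction keeps the argument of [quantile] in [0, 1], where [quantileP]
   applies. *)
Definition unit_retract (u : R) : R := if 0 < u < 1 then u else 2^-1.

Lemma unit_retract01 u : 0 < unit_retract u < 1.
Proof. by rewrite /unit_retract; case: ifP => // _; apply/andP; split; lra. Qed.

Lemma measurable_unit_retract : measurable_fun setT unit_retract.
Proof.
apply: measurable_fun_ifT => //.
by apply: measurable_and => //; exact: measurable_fun_ltr.
Qed.

Definition quantile_var (u : measurableTypeR R) : R := quantile (unit_retract u).

Lemma quantile_varP u y :
  (quantile_var u <= y) = ((unit_retract u)%:E <= mu `]-oo, y]%classic)%E.
Proof. exact/quantileP/unit_retract01. Qed.

Lemma quantile_var_homo u v : unit_retract u <= unit_retract v ->
  quantile_var u <= quantile_var v.
Proof.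
move=> uv; rewrite quantile_varP.
have : quantile_var v <= quantile_var v by [].
by rewrite [in X in X -> _]quantile_varP; apply: le_trans; rewrite lee_fin.
Qed.

Let fineF y : mu `]-oo, y]%classic = (fine (mu `]-oo, y]%classic))%:E.
Proof. by rewrite fineK// fin_num_measure. Qed.

Lemma measurable_quantile_var : measurable_fun setT quantile_var.
Proof.
apply: (measurability (@RGenOInfty.G R)) => [|/= _ [_] [y] -> <-].
  exact: RGenOInfty.measurableE.
rewrite setTI (_ : _ @^-1` _ = unit_retract @^-1` `]fine (mu `]-oo, y]%classic), +oo[).
  by rewrite -[X in measurable X]setTI; exact: measurable_unit_retract.
apply/seteqP; split => u /=; rewrite !in_itv/= !andbT !ltNge quantile_varP fineF lee_fin.
  by [].
by [].
Qed.

(** By [quantile_varP] the two laws agree on the rays []y, +oo[], which are stable under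
    intersection and generate the Borel sets. *)
Lemma quantile_var_distribution (A : set (measurableTypeR R)) : measurable A ->
  uniform01 (quantile_var @^-1` A) = mu A.
Proof.
have mQ : @measurable_fun _ _ (measurableTypeR R) (measurableTypeR R) setT quantile_var.
  exact: measurable_quantile_var.
pose Q : {mfun measurableTypeR R >-> measurableTypeR R} :=
  HB.pack quantile_var (isMeasurableFun.Build _ _ _ _ _ mQ).
move=> mA; rewrite -[LHS]/(distribution uniform01 Q A).
apply: (@measure_unique _ R (measurableTypeR R) (@RGenOInfty.G R) (fun n => `](- n%:R), +oo[%classic)
  _ _ _ _ (distribution uniform01 Q) mu) => //.
- exact: RGenOInfty.measurableE.
- move=> _ _ [x ->] [y ->]; exists (Num.max x y).
  apply/seteqP; split => z /=; rewrite !in_itv/= !andbT gt_max.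
    by move=> [-> ->].
  by move=> /andP.
- by move=> n; exists (- n%:R).
- rewrite -subTset => x _; exists (Num.bound `|x|) => //=.
  rewrite in_itv/= andbT ltrNl; apply: le_lt_trans (archi_boundP (normr_ge0 x)).
  by rewrite -normrN ler_norm.
- move=> _ [y ->].
  have PC (p : probability (measurableTypeR R) R) :
      p `]y, +oo[%classic = (1 - p `]-oo, y]%classic)%E.
    by rewrite -setCitvl; exact: probability_setC.
  rewrite [LHS](PC (distribution uniform01 Q)) [RHS](PC mu); congr (1 - _)%E.
  rewrite /= /distribution /pushforward/= fineF.
  have /andP[F0 F1] : 0 <= fine (mu `]-oo, y]%classic) <= 1.
    by rewrite -!lee_fin -fineF measure_ge0 probability_le1.
  rewrite -uniform01_itvNy ?F0//.
  (* On the full-measure set []0, 1[] the map [unit_retract] is the identity. *)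
  apply: (@probability_eq_on _ _ _ uniform01 `]0%R, 1%R[%classic) => //.
  + rewrite -[X in measurable X]setTI; apply: measurable_quantile_var => //.
  + by rewrite (uniform01_itv false true)// subr0.
  + apply/seteqP; split => u /=; rewrite !in_itv/= quantile_varP fineF lee_fin.
      by move=> [+ u01]; rewrite /unit_retract u01.
    by move=> [+ u01]; rewrite /unit_retract u01.
- move=> n; apply: le_lt_trans (ltry 1); exact: probability_le1.
Qed.

End quantile.

(** * Range and injectivity of the semicircle quantile function *)

Section semicircle_quantile.
Context {R : realType}.
Local Notation sigma := (@semicircle_prob R).
Local Notation leb := (@lebesgue_measure R).

Lemma semicircle_pdf_le1 (x : R) : semicircle_pdf x <= 1.
Proof.
have pi2 := pi_ge2 R.
rewrite /semicircle_pdf ler_pdivrMr ?mul1r; last by lra.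
apply: (@le_trans _ _ 2); last by lra.
have -> : 2 = Num.sqrt (2 ^+ 2) :> R by rewrite sqrtr_sqr ger0_norm.
by rewrite ler_sqrt// ge_max sqr_ge0 andbT (_ : 2 ^+ 2 = 4)// ?gerBl ?sqr_ge0//; ring.
Qed.

Lemma semicircle_cdf_lipschitz (a b : R) : a <= b ->
  (sigma `]-oo, b]%classic <= sigma `]-oo, a]%classic + (b - a)%:E)%E.
Proof.
move=> ab; rewrite (_ : `]-oo, b]%classic = `]-oo, a] `|` `]a, b]); last first.
  by rewrite -itv_bndbnd_setU// bnd_simp.
apply: (le_trans (measureU2 _ _ _)) => //; apply: leeD => //.
rewrite /semicircle_prob /=.
have -> : (b - a)%:E = (\int[leb]_(x in `]a, b]) 1)%E.
  rewrite integral_cst//= mul1e lebesgue_measure_itv/= lte_fin.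
  by case: ltgtP ab => // -> _; rewrite subrr.
apply: ge0_le_integral => //.
- by move=> x _; rewrite lee_fin semicircle_pdf_ge0.
- by apply/measurable_EFinP/measurable_funTS; exact: measurable_semicircle_pdf.
- by move=> x _; rewrite lee_fin semicircle_pdf_le1.
Qed.

Lemma semicircle_itv (A : set R) : (forall x, A x -> 2 <= `|x|) -> sigma A = 0%E.
Proof.
move=> A2; rewrite /semicircle_prob /= integral0_eq// => x Ax.
by rewrite semicircle_pdf_out// A2.
Qed.

Lemma semicircle_quantile_le2 u : `|quantile_var sigma u| <= 2.
Proof.
have /andP[u0 u1] := unit_retract01 u.
rewrite ler_norml; apply/andP; split; last first.
  have s2 : sigma `]-oo, 2]%classic = 1%E.
    rewrite -[`]-oo, 2]%classic]setCK setCitvl.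
    rewrite [LHS](@probability_setC _ _ _ sigma)//.
    have sC : sigma `]2, +oo[%classic = 0%E.
      rewrite semicircle_itv// => x /=.
      by rewrite in_itv/= andbT => x2; rewrite ler_normr ltW.
    by rewrite [X in (1 - X)%E]sC sube0.
  by rewrite quantile_varP [X in (_ <= X)%E]s2 lee_fin ltW.
rewrite leNgt; apply/negP => /ltW; rewrite quantile_varP.
have sN2 : sigma `]-oo, (-2)%R]%classic = 0%E.
  rewrite semicircle_itv// => x /=.
  by rewrite in_itv/= => x2; rewrite ler_normr; apply/orP; right; lra.
by rewrite [X in (_ <= X)%E]sN2 lee_fin leNgt u0.
Qed.

(** A value [x] shared by two levels at distance [e] would force the distribution function to grow
    by more than [e] on []x - e, x]], against its Lipschitz constant 1. Hence the second variable is
    a function of the semicircular one. *)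
Lemma semicircle_quantile_inj u v :
  quantile_var sigma u = quantile_var sigma v -> unit_retract u = unit_retract v.
Proof.
have H s t : quantile_var sigma s = quantile_var sigma t -> unit_retract s < unit_retract t -> False.
  move=> st lst; set x := quantile_var sigma s.
  pose e := unit_retract t - unit_retract s.
  have e0 : 0 < e by rewrite subr_gt0.
  have t_le : ((unit_retract t)%:E <= sigma `]-oo, x]%classic)%E by rewrite -quantile_varP /x st.
  have s_gt : (sigma `]-oo, (x - e)%R]%classic < (unit_retract s)%:E)%E.
    by rewrite ltNge -quantile_varP -ltNge -/x ltrBlDr ltrDl.
  have := semicircle_cdf_lipschitz (_ : x - e <= x).
  rewrite lerBlDr lerDl (ltW e0) => /(_ isT).
  rewrite (_ : x - (x - e) = e); last by ring.
  move/(le_trans t_le); apply/negP; rewrite -ltNge.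
  rewrite (_ : unit_retract t = unit_retract s + e); last by rewrite /e; ring.
  by rewrite (EFinD (unit_retract s)) lteD2rE.
move=> uv; apply/eqP; rewrite eq_le !leNgt; apply/andP; split; apply/negP => lt.
  exact: H (esym uv) lt.
exact: H uv lt.
Qed.

End semicircle_quantile.

(** * Upper bound on the double logarithmic integral *)

Section log_energy.
Context d (T : measurableType d) (R : realType) (P : probability T R).
Variables X Y : T -> R.
Hypothesis mX : measurable_fun setT X.
Hypothesis mY : measurable_fun setT Y.
Hypothesis X2 : forall u, `|X u| <= 2.
Hypothesis XU : forall n, (\int[P]_u (chebU (X u) n)%:E = (n == 1)%:R%:E)%E.
Hypothesis iY : P.-integrable setT (EFin \o Y).
Hypothesis mono : forall u v, 0 <= (Y u - Y v) * (X u - X v).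
Hypothesis inj : forall u v, X u = X v -> Y u = Y v.
Variable rho : R.
Hypothesis XY : (\int[P]_u (X u * Y u)%:E = rho%:E)%E.

Let quot (z : T * T) := (Y z.1 - Y z.2) / (X z.1 - X z.2).

Let mquot : measurable_fun setT quot. Proof. exact: measurable_quot. Qed.

Let quot_ge0 z : 0 <= quot z. Proof. exact: quot_ge0. Qed.

Let int_quot : (\int[P \x P]_z (quot z)%:E <= rho%:E)%E.
Proof.
have := integral_quot_le mX mY X2 XU iY mono inj.
by rewrite XY.
Qed.

(** The moment dominates the integral of a nonnegative quotient; this places [acos rho] in
    [[0, pi / 2]], as [ln_le_acos] requires. *)
Lemma comonotone_moment_ge0 : 0 <= rho.
Proof.
rewrite -lee_fin; apply: le_trans int_quot.
by apply: integral_ge0 => z _; rewrite lee_fin.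
Qed.

Let iquot : (P \x P)%E.-integrable setT (EFin \o quot).
Proof.
apply/integrableP; split; first exact/measurable_EFinP.
under eq_integral => z _ do rewrite /= ger0_norm//.
exact: le_lt_trans int_quot (ltry _).
Qed.

Let t n (z : T * T) := chebT (X z.1) n * chebT (X z.2) n.

Let it n : (P \x P)%E.-integrable setT (EFin \o t n).
Proof.
apply: (@integrable_le _ _ _ _ _ 1) => [|z].
  have mT := measurableT_comp (continuous_measurable_fun (@continuous_chebT R n)) mX.
  apply: measurable_funM; [exact: measurableT_comp mT measurable_fst|].
  exact: measurableT_comp mT measurable_snd.
by rewrite normrM mulr_ile1// chebT_le1.
Qed.

Let int_t n : (\int[P \x P]_z (t n.+1 z)%:E = (4^-1 *+ (n == 1))%:E)%E.
Proof.
rewrite -(integral12_prod_meas1 (it n.+1)) /fubini_F /t /=.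
under eq_integral => u _.
  under eq_integral do rewrite EFinM.
  rewrite integralZl//; last exact: integrable_chebT.
  rewrite integral_chebT// muleC.
  over.
rewrite integralZl//; last exact: integrable_chebT.
rewrite integral_chebT// -EFinM; congr (_%:E).
by case: (n == 1); rewrite /= ?mulr1n ?mulr0n; field.
Qed.

Let S r N (z : T * T) := \sum_(n < N) r ^+ n.+1 * t n.+1 z / n.+1%:R.

Let iterm r n : (P \x P)%E.-integrable setT
  (EFin \o (fun z => r ^+ n.+1 * t n.+1 z / n.+1%:R)).
Proof.
rewrite (_ : _ \o _ = fun z => ((r ^+ n.+1 / n.+1%:R)%:E * (t n.+1 z)%:E)%E).
  exact: (integrableZl measurableT _ (it n.+1)).
by apply/funext => z; rewrite /= -EFinM mulrAC.
Qed.

Let iS r N : (P \x P)%E.-integrable setT (EFin \o S r N).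
Proof.
rewrite (_ : EFin \o _ = fun z => (\sum_(n < N) (r ^+ n.+1 * t n.+1 z / n.+1%:R)%:E)%E).
  exact: (@integrable_sum _ _ _ _ _ measurableT _ _ _
    (fun n : 'I_N => EFin \o (fun z => r ^+ n.+1 * t n.+1 z / n.+1%:R))).
by apply/funext => z; rewrite /= sumEFin.
Qed.

(** Only degree 2 survives, contributing [r ^ 2 * (1 / 4) / 2]; two terms suffice to include it. *)
Let int_S r N : (\int[P \x P]_z (S r N.+2 z)%:E = (r ^+ 2 / 8)%:E)%E.
Proof.
under eq_integral do rewrite -sumEFin.
rewrite integral_sum//; last by move=> n; exact: iterm.
have E n : (\int[P \x P]_z (r ^+ n.+1 * t n.+1 z / n.+1%:R)%:E =
    ((r ^+ n.+1 / n.+1%:R) * (4^-1 *+ (n == 1)))%:E)%E.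
  under eq_integral do rewrite mulrAC EFinM.
  by rewrite integralZl//; [rewrite int_t -EFinM|exact: it].
under eq_bigr => n _ do rewrite E.
rewrite sumEFin !big_ord_recl/= big1 => [|n _]; last by rewrite mulr0n mulr0.
congr (_%:E); rewrite /bump/= ?mulr0n ?mulr1n. by field.
Qed.

(** Off the diagonal, [|Y z.1 - Y z.2|] factors as [|X z.1 - X z.2| * quot z], and the bounds on the
    two logarithms are added. When the [Y] values coincide, the left side is [-oo]. *)
Lemma lne_diff_le c r N z : 0 < r < 1 ->
  (forall q, 0 < q -> ln q <= c * (q - rho) - acos rho ^+ 2 / 2) ->
  (lne `|Y z.1 - Y z.2|%:E <= (- ln r - c * rho - acos rho ^+ 2 / 2
    + 64 * r ^+ N / (1 - r) ^+ 4 + (c * quot z - 2 * S r N z))%:E)%E.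
Proof.
move=> r01 lnq.
have [Yz|Yz] := eqVneq (Y z.1) (Y z.2).
  by rewrite Yz subrr normr0 le0_lneNy// leNye.
have Xz : X z.1 != X z.2 by apply: contra_neq Yz; exact: inj.
have X0 : X z.1 - X z.2 != 0 by rewrite subr_eq0.
have q0 : 0 < quot z.
  by rewrite lt_neqAle eq_sym quot_ge0 andbT mulf_neq0 ?invr_eq0// subr_eq0.
have dX0 : 0 < `|X z.1 - X z.2| by rewrite normr_gt0.
have YE : `|Y z.1 - Y z.2| = `|X z.1 - X z.2| * quot z.
  by rewrite -[in RHS](gtr0_norm q0) -normrM /quot mulrC divfK.
have lnE : ln `|Y z.1 - Y z.2| = ln `|X z.1 - X z.2| + ln (quot z).
  by rewrite YE lnM ?posrE.
rewrite lne_EFin ?normr_gt0 ?subr_eq0// lnE lee_fin.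
have := ln_norm_le_chebT N (X2 z.1) (X2 z.2) Xz r01.
rewrite -/(S r N z); have := lnq _ q0.
move: (ln (quot z)) (ln `|_|) (ln r) (S r N z) (64 * _ / _) (quot z) => a b e s k q.
move: (acos rho ^+ 2) => A; lra.
Qed.

Let E (z : T * T) : \bar R := lne `|Y z.1 - Y z.2|%:E.

Lemma measurable_lne_diff : measurable_fun setT E.
Proof.
have mD : measurable_fun setT (fun z : T * T => `|Y z.1 - Y z.2|).
  apply: measurableT_comp => //; apply: measurable_funB.
    exact: measurableT_comp mY measurable_fst.
  exact: measurableT_comp mY measurable_snd.
apply: measurable_fun_ifT => //; first exact: measurable_fun_ler.
apply/measurable_EFinP.
by apply: (measurableT_comp _ mD); exact: measurable_ln.
Qed.

Lemma log_energy_le_aux c r N : 0 < r < 1 -> 0 <= c ->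
  (forall q, 0 < q -> ln q <= c * (q - rho) - acos rho ^+ 2 / 2) ->
  (\int[P]_v \int[P]_u E (u, v) <= (- ln r - acos rho ^+ 2 / 2
    + 64 * r ^+ N.+2 / (1 - r) ^+ 4 - r ^+ 2 / 4)%:E)%E.
Proof.
move=> r01 c0 lnq.
pose K := - ln r - c * rho - acos rho ^+ 2 / 2 + 64 * r ^+ N.+2 / (1 - r) ^+ 4.
pose G z := K + (c * quot z - 2 * S r N.+2 z).
have icq : (P \x P)%E.-integrable setT (EFin \o (fun z => c * quot z)).
  exact: (integrableZl measurableT c iquot).
have i2S : (P \x P)%E.-integrable setT (EFin \o (fun z => 2 * S r N.+2 z)).
  exact: (integrableZl measurableT 2 (iS r N.+2)).
have iD : (P \x P)%E.-integrable setT (EFin \o (fun z => c * quot z - 2 * S r N.+2 z)).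
  exact: (integrableB measurableT icq i2S).
have PP1 : (P \x P)%E setT = 1%E by exact: (@probability_setT _ _ _ (P \x P)%E).
have iK : (P \x P)%E.-integrable setT (EFin \o (cst K : T * T -> R)).
  exact: (@integrable_le _ _ _ (P \x P)%E (cst K) `|K|).
have iG : (P \x P)%E.-integrable setT (EFin \o G).
  exact: (integrableD measurableT iK iD).
have mG : measurable_fun setT (EFin \o G) := measurable_int _ iG.
have slice (F : T * T -> \bar R) v : measurable_fun setT F ->
    measurable_fun setT (fun u => F (u, v)).
  exact: measurable_fun_pair1.
(* Only the majorant [G] is known to be integrable: the comparison is made inside the iterated
   integral, and Fubini's theorem is then applied to [G] alone. *)
apply: (@le_trans _ _ (\int[P]_v \int[P]_u (G (u, v))%:E)%E).
  apply: le_integral_measurable.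
  - exact: measurable_fun_fubini_G measurable_lne_diff.
  - exact: measurable_fun_fubini_G mG.
  - move=> v; apply: le_integral_measurable.
    + exact: slice measurable_lne_diff.
    + exact: slice mG.
    + by move=> u; exact: (@lne_diff_le c r N.+2 (u, v)).
have -> : (\int[P]_v \int[P]_u (G (u, v))%:E = \int[P \x P]_z (G z)%:E)%E.
  exact: (integral21_prod_meas1 iG).
rewrite (integralD_EFin measurableT iK iD) (integralB_EFin measurableT icq i2S).
have -> : (\int[P \x P]_z (c * quot z)%:E = c%:E * \int[P \x P]_z (quot z)%:E)%E.
  exact: (integralZl measurableT iquot).
have -> : (\int[P \x P]_z (2 * S r N.+2 z)%:E = (2 * (r ^+ 2 / 8))%:E)%E.
  by rewrite EFinM -(int_S r N); exact: (integralZl measurableT (iS r N.+2)).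
have -> : (\int[P \x P]_z (cst K z)%:E = K%:E)%E.
  by rewrite (eq_integral (cst K%:E))// integral_cst// [X in (_ * X)%E]PP1 mule1.
have -> : (- ln r - acos rho ^+ 2 / 2 + 64 * r ^+ N.+2 / (1 - r) ^+ 4 - r ^+ 2 / 4 =
    K + (c * rho - 2 * (r ^+ 2 / 8))) by rewrite /K; move: (64 * _ / _) => k; field.
rewrite [leRHS]EFinD; apply: leeD => //.
rewrite [leRHS]EFinB; apply: leeB => //.
by rewrite [leRHS]EFinM; apply: lee_wpmul2l => //; rewrite lee_fin.
Qed.

Lemma log_energy_le : rho <= 1 ->
  (\int[P]_v \int[P]_u E (u, v) <= (- 4^-1 - acos rho ^+ 2 / 2)%:E)%E.
Proof.
move=> rho1.
have [|c c0 lnq] := @ln_le_acos R rho; first by rewrite comonotone_moment_ge0.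
apply/lee_addgt0Pr => e e0.
(* For [r = 1 / s], the error [- ln r] is at most [e / 3] and [(1 - r ^ 2) / 4] at most [e / 6]. The
   truncation error is brought below [e / 3] by choosing [N] after [r], because of its factor
   [(1 - r) ^ -4]. *)
pose s := 1 + e / 3; have s1 : 1 < s by rewrite /s; lra.
have s0 : 0 < s by exact: lt_trans s1.
pose r := s^-1.
have r0 : 0 < r by rewrite invr_gt0.
have r1 : r < 1 by rewrite invf_lt1.
have lnr : - ln r <= e / 3.
  by rewrite /r lnV ?posrE// opprK; apply: le_ln1Dx; lra.
have rs : 1 - e / 3 <= r.
  rewrite /r -[leRHS]mul1r ler_pdivlMr// /s.
  by have := sqr_ge0 (e / 3); rewrite expr2; move: (e / 3) => e'; lra.
have r2 : 1 - 2 * (e / 3) <= r ^+ 2.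
  by have := sqr_ge0 (r - 1); rewrite sqrrB1; lra.
have [N rN] : exists N, 64 * r ^+ N.+2 / (1 - r) ^+ 4 <= e / 3.
  have : 64 * r ^+ n / (1 - r) ^+ 4 @[n --> \oo] --> (0 : R).
    rewrite (_ : 0 = 64 * 0 / (1 - r) ^+ 4); last by rewrite mulr0 mul0r.
    apply: cvgM; last exact: cvg_cst.
    apply: cvgM; first exact: cvg_cst.
    by apply: cvg_expr; rewrite gtr0_norm.
  move=> /cvgr_le /(_ (e / 3)) [|N _ NN]; first by rewrite divr_gt0.
  by exists N; apply: NN => /=; rewrite -[N.+2]addn2 leq_addr.
apply: le_trans (@log_energy_le_aux c r N _ c0 lnq) _; first by rewrite r0.
rewrite -EFinD lee_fin.
move: (acos rho ^+ 2) (64 * _ / _) rN => A k; lra.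
Qed.

End log_energy.

(** * Change of variables to the uniform space *)

Section transfer.
Context d (T : measurableType d) (R : realType) (P : probability T R).
Local Notation bR := (measurableTypeR R).
Variables (phi : T -> bR) (nu : probability bR R).
Hypothesis mphi : measurable_fun setT phi.
Hypothesis phi_nu : forall A, measurable A -> P (phi @^-1` A) = nu A.

Lemma ge0_integral_transfer (f : bR -> \bar R) : measurable_fun setT f ->
  (forall x, 0 <= f x)%E -> (\int[nu]_x f x = \int[P]_u f (phi u))%E.
Proof.
move=> mf f0.
rewrite -(ge0_integral_pushforward mphi P measurableT mf) => [|x _]; last exact: f0.
by apply: eq_measure_integral => A mA _; exact/esym/phi_nu.
Qed.

Lemma integral_transfer (f : bR -> \bar R) : measurable_fun setT f ->
  (\int[nu]_x f x = \int[P]_u f (phi u))%E.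
Proof.
move=> mf; rewrite integralE [RHS]integralE; congr (_ - _)%E.
  rewrite (ge0_integral_transfer (measurable_funepos mf) (funepos_ge0 f)).
  by apply: eq_integral => u _; rewrite !funeposE.
rewrite (ge0_integral_transfer (measurable_funeneg mf) (funeneg_ge0 f)).
by apply: eq_integral => u _; rewrite !funenegE.
Qed.

End transfer.

(** * Wasserstein distance and the arcsine *)

Section wasserstein.
Context d (T : measurableType d) (R : realType) (P : probability T R).
Local Notation bR := (measurableTypeR R).
Variables (phi psi : T -> bR) (mu nu : probability bR R).
Hypothesis mphi : measurable_fun setT phi.
Hypothesis mpsi : measurable_fun setT psi.
Hypothesis phi_mu : forall A, measurable A -> P (phi @^-1` A) = mu A.
Hypothesis psi_nu : forall A, measurable A -> P (psi @^-1` A) = nu A.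

(** The joint law of [phi] and [psi] is a coupling. The infimum lies between 0 and [C], so [fine]
    preserves its value. *)
Lemma W2_le (C : R) :
  (\int[P]_u (`|phi u - psi u| ^+ 2)%:E <= C%:E)%E -> W2 mu nu <= Num.sqrt C.
Proof.
move=> costC.
have mpair : measurable_fun setT (fun u => (phi u, psi u)).
  exact: measurable_fun_pair.
pose pr : {mfun T >-> (bR * bR)%type} :=
  HB.pack (fun u => (phi u, psi u)) (isMeasurableFun.Build _ _ _ _ _ mpair).
rewrite /W2; set S := [set _ | g in _].
have SC : (ereal_inf S <= C%:E)%E.
  apply: le_trans costC; apply: ereal_inf_lbound.
  exists (distribution P pr).
    by split => A mA; [exact: phi_mu|exact: psi_nu].
  rewrite ge0_integral_distribution//.
  apply/measurable_EFinP; apply: measurable_funX; apply: measurableT_comp => //.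
  by apply: measurable_funB; [exact: measurable_fst|exact: measurable_snd].
have S0 : (0 <= ereal_inf S)%E.
  apply: le_ereal_inf_tmp => _ [g _ <-].
  by apply: integral_ge0 => z _; rewrite lee_fin exprn_ge0.
apply: ler_wsqrtr; rewrite -lee_fin fineK// ge0_fin_numE//.
exact: le_lt_trans SC (ltry C).
Qed.

End wasserstein.

(** [sqrt (2 - 2 * cos t)] is the chord [2 * sin (t / 2)] of an arc [t], and the monotone arcsine
    turns a bound on the chord into one on the arc. *)
Lemma asin_sin_half_le (R : realType) (w t : R) : 0 <= w -> 0 <= t <= pi / 2 ->
  w <= Num.sqrt (2 - 2 * cos t) -> 4 * asin (2^-1 * w) ^+ 2 <= t ^+ 2.
Proof.
move=> w0 /andP[t0 tpi] wt; have pi0 := pi_gt0 R.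
have sE : Num.sqrt (2 - 2 * cos t) = 2 * sin (t / 2).
  have -> : 2 - 2 * cos t = (2 * sin (t / 2)) ^+ 2.
    rewrite {1}(_ : t = t / 2 + t / 2); last by field.
    rewrite cosD exprMn; have := cos2Dsin2 (t / 2).
    by move: (cos _) (sin _) => c s; nra.
  rewrite sqrtr_sqr ger0_norm// mulr_ge0// sin_ge0_pi//.
  by apply/andP; split; lra.
have wI : -1 <= 2^-1 * w <= 1.
  have := sin_le1 (t / 2); move: wt; rewrite sE => ? ?.
  by apply/andP; split; lra.
have sa : sin (asin (2^-1 * w)) = 2^-1 * w by apply: asinK; rewrite in_itv.
have a0 : 0 <= asin (2^-1 * w).
  rewrite leNgt; apply/negP => a_lt0.
  have : sin (asin (2^-1 * w)) < sin 0.
    rewrite ltr_sin// ?in_itv/= ?asin_geNpi2 ?asin_lepi2//.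
    by apply/andP; split; lra.
  by rewrite sa sin0 ltNge mulr_ge0.
have at2 : asin (2^-1 * w) <= t / 2.
  rewrite leNgt; apply/negP => ta.
  have : sin (t / 2) < sin (asin (2^-1 * w)).
    rewrite ltr_sin// ?in_itv/= ?asin_geNpi2 ?asin_lepi2//.
    by apply/andP; split; lra.
  by rewrite sa ltNge; move: wt; rewrite sE => ?; apply/negP; rewrite negbK; lra.
by move: (asin _) a0 at2 => a a0 at2; nra.
Qed.

Unset Implicit Arguments.

Theorem proposition5p4 (R : realType) (mu : probability (measurableTypeR R) R)
    (hmu : S01 mu) :
  ((4 * asin (2^-1 * W2 mu (@semicircle_prob R)) ^+ 2)%:E <= 2%:E * Ilog mu)%E.
Proof.
case: hmu => _ _ mu2.
pose sigma := @semicircle_prob R; pose P := @uniform01 R.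
pose X := quantile_var sigma; pose Y := quantile_var mu.
have mX : measurable_fun setT X := measurable_quantile_var sigma.
have mY : measurable_fun setT Y := measurable_quantile_var mu.
have XD A : measurable A -> P (X @^-1` A) = sigma A.
  exact: quantile_var_distribution.
have YD A : measurable A -> P (Y @^-1` A) = mu A.
  exact: quantile_var_distribution.
have X2 : forall u, `|X u| <= 2 := @semicircle_quantile_le2 R.
have XU n : (\int[P]_u (chebU (X u) n)%:E = (n == 1)%:R%:E)%E.
  rewrite -(integral_semicircle_chebU n) (integral_transfer mX XD).
    by apply: eq_integral => u _; rewrite clamp2_id.
  apply/measurable_EFinP; apply: continuous_measurable_fun => x.
  exact: (continuous_comp (@continuous_clamp2 R x) (@continuous_chebU R n _)).
have mono u v : 0 <= (Y u - Y v) * (X u - X v).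
  case: (leP (unit_retract u) (unit_retract v)) => [uv|/ltW vu].
    by rewrite mulr_le0// subr_le0; exact: quantile_var_homo.
  by rewrite mulr_ge0// subr_ge0; exact: quantile_var_homo.
have inj u v : X u = X v -> Y u = Y v.
  by move=> /semicircle_quantile_inj uv; rewrite /Y /quantile_var uv.
have msqr : measurable_fun setT (fun x : R => (x ^+ 2)%:E).
  by apply/measurable_EFinP; exact: exprn_measurable.
have Ysqr : (\int[P]_u (Y u ^+ 2)%:E = 1)%E.
  by rewrite -mu2 (integral_transfer mY YD).
have Xsqr : (\int[P]_u (X u ^+ 2)%:E = 1)%E := integral_sqr_semicircular mX X2 XU.
have mX2 : measurable_fun setT (fun u => X u ^+ 2) by exact: measurable_funX.
have mY2 : measurable_fun setT (fun u => Y u ^+ 2) by exact: measurable_funX.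
have iX2 : P.-integrable setT (EFin \o (fun u => X u ^+ 2)).
  apply/integrableP; split; first exact/measurable_EFinP.
  under eq_integral do rewrite /= ger0_norm ?sqr_ge0//.
  by rewrite Xsqr ltry.
have iY2 : P.-integrable setT (EFin \o (fun u => Y u ^+ 2)).
  apply/integrableP; split; first exact/measurable_EFinP.
  under eq_integral do rewrite /= ger0_norm ?sqr_ge0//.
  by rewrite Ysqr ltry.
have i1 : P.-integrable setT (EFin \o (cst 1 : R -> R)).
  exact: (@integrable_le _ _ _ P (cst 1) `|1|).
have iY : P.-integrable setT (EFin \o Y).
  (* The majorant is [1 + Y ^ 2], which dominates [|Y|]. *)
  apply: (le_integrable measurableT _ _ (integrableD measurableT i1 iY2)).
    exact/measurable_EFinP.
  move=> u _; rewrite /= lee_fin [leRHS]ger0_norm ?addr_ge0 ?sqr_ge0//.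
  by rewrite -[Y u ^+ 2]real_normK ?num_real//; move: `|Y u| => y; nra.
have iXY := integrable_mulXY mX mY X2 iY.
pose rho := fine (\int[P]_u (X u * Y u)%:E)%E.
have XY : (\int[P]_u (X u * Y u)%:E = rho%:E)%E.
  by rewrite /rho fineK//; exact: integrable_fin_num iXY.
have cost : (\int[P]_u (`|Y u - X u| ^+ 2)%:E = (2 - 2 * rho)%:E)%E.
  transitivity (\int[P]_u (((X u ^+ 2)%:E + (Y u ^+ 2)%:E) - (2 * (X u * Y u))%:E))%E.
    apply: eq_integral => u _; rewrite real_normK ?num_real//=.
    by congr (_%:E); ring.
  have i2XY : P.-integrable setT (EFin \o (fun u => 2 * (X u * Y u))).
    exact: (integrableZl measurableT 2 iXY).
  rewrite (integralB measurableT (integrableD measurableT iX2 iY2) i2XY).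
  rewrite (integralD measurableT iX2 iY2).
  have -> : (\int[P]_u (2 * (X u * Y u))%:E = (2 * rho)%:E)%E.
    by rewrite EFinM -XY; exact: (integralZl measurableT iXY).
  rewrite [X in (X + _ - _)%E]Xsqr [X in (_ + X - _)%E]Ysqr /=.
  by congr (_%:E); ring.
have rho0 : 0 <= rho := comonotone_moment_ge0 mX mY X2 XU iY mono inj XY.
have rho1 : rho <= 1.
  have : (0 <= (2 - 2 * rho)%:E)%E.
    by rewrite -cost; apply: integral_ge0 => u _; rewrite lee_fin exprn_ge0.
  by rewrite lee_fin; lra.
have rhoI : -1 <= rho <= 1 by apply/andP; split; lra.
set t := acos rho.
have ct : cos t = rho by rewrite acosK// in_itv.
have t0 : 0 <= t by exact: acos_ge0.
have tpi : t <= pi / 2.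
  rewrite leNgt; apply/negP => pit; have pi0 := pi_gt0 R.
  have : cos t < cos (pi / 2).
    rewrite ltr_cos ?in_itv/= ?t0 ?acos_lepi//.
    by apply/andP; split; lra.
  by rewrite cos_pihalf ct ltNge rho0.
have W2t : 4 * asin (2^-1 * W2 mu sigma) ^+ 2 <= t ^+ 2.
  apply: asin_sin_half_le; rewrite ?t0 ?sqrtr_ge0//.
  by rewrite ct; apply: (W2_le mY mX YD XD); rewrite cost.
pose I := (\int[mu]_y \int[mu]_x lne `|x - y|%:E)%E.
have IE : I = (\int[P]_v \int[P]_u lne `|Y u - Y v|%:E)%E.
  have mlne : measurable_fun setT
      (fun z : measurableTypeR R * measurableTypeR R => lne `|z.1 - z.2|%:E).
    apply: (measurable_lne_diff (Y := fun x : measurableTypeR R => x : R)).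
    exact: measurable_id.
  rewrite /I (integral_transfer mY YD); last first.
    exact: (@measurable_fun_fubini_G _ (measurableTypeR R) R mu (fun z => lne `|z.1 - z.2|%:E) mlne).
  apply: eq_integral => v _; rewrite (integral_transfer mY YD)//.
  exact: (measurable_fun_pair1 _ mlne).
have Ile : (I <= (- 4^-1 - t ^+ 2 / 2)%:E)%E.
  rewrite IE.
  exact: (log_energy_le mX mY X2 XU iY mono inj XY rho1).
(* The constants cancel: [I <= - 1/4 - t ^ 2 / 2] gives [2 * (- I + 1/2 - 3/4) >= t ^ 2]. *)
rewrite /Ilog -/I mu2 mule1.
apply: (@le_trans _ _ (t ^+ 2)%:E); first by rewrite lee_fin.
(* The value [+oo] is excluded by [Ile], and for [-oo] the energy is [+oo]. *)
clear IE; clearbody I; case: I Ile => [i| |] //=.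
  rewrite -?EFinN -?EFinD -?EFinM !lee_fin => ile.
  by move: (t ^+ 2) ile => A; lra.
by move=> _; rewrite gt0_muley ?leey// lte_fin.
Qed.
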